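(* Let $2\le s<\infty$ with Hölder conjugate $s'$, and let $\mathcal R(\varphi)$ be either one of the following two quantities: (i) $\mathcal R(\varphi)=\dfrac{\|\varphi\|_{L^p(\mathbb T)}\|\varphi\|_{L^q(\mathbb T)}}{\|\varphi\|_{L^r(\mathbb T)}}$, where $1\le p,q,r\le\infty$ satisfy $\frac1p+\frac1q-\frac1r\ge 1+\frac1s$; or (ii) $\mathcal R(\varphi)=\dfrac{\|\varphi\|_{L^1(\mathbb T)}^{1+r'/s}}{\|\varphi\|_{L^r(\mathbb T)}^{r'/s}}$, where $r\in(1,\infty]$ and $r'$ is the Hölder conjugate of $r$. Then there is a constant $C>0$ depending only on $s,r$ such that the following holds. Let $M>0$ and suppose that a nonzero $\varphi\in C(\mathbb T,\mathbb R)$ with zero mean and $N_\varphi<\infty$ can be written as $$\varphi=h+g,\qquad \hat h(k)=0\ \text{ for } 0<|k|<M,\qquad \hat h,\hat g\in\ell^{s'}(\mathbb Z).$$ Then $$N_\varphi\;\ge\; C\,\frac{\mathcal R(\varphi)}{M^{-1}\|\hat h\|_{\ell^{s'}(\mathbb Z)}+\|g\|_{\mathcal FL^{s'}_{-1}(\mathbb T)}} .$$ In particular, let $r\in(1,\infty]$ and $\Lambda\ge 1$; there is a constant $c>0$ depending only on $s,r,\Lambda$ such that if, for such $\varphi,h,g,M$, the quantities $\|\varphi\|_{L^1(\mathbb T)}$, $\|\varphi\|_{L^r(\mathbb T)}$, $\|\hat h\|_{\ell^{s'}(\mathbb Z)}$ all lie in $[\Lambda^{-1},\Lambda]$ and $\|g\|_{\mathcal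 FL^{s'}_{-1}(\mathbb T)}\le\Lambda M^{-1}$, then $N_\varphi\ge cM$.
   Context: $\mathbb T=\mathbb R/\mathbb Z$ is the one-dimensional torus with normalized Lebesgue measure (total mass $1$); $\hat f(k)$ denotes the $k$-th Fourier coefficient of $f$, i.e. $\hat f(k)=\int_{\mathbb T}f(x)e^{-2\pi i kx}\,dx$ for integrable $f$; zero mean means $\int_{\mathbb T}\varphi\,dx=0$. Here $h,g$ are functions on $\mathbb T$ (they belong to $L^2(\mathbb T)$, since $\hat h,\hat g\in\ell^{s'}\subseteq\ell^2$). The Fourier–Lebesgue seminorm is $$\|g\|_{\mathcal FL^{s'}_{-1}(\mathbb T)}:=\Big(\sum_{k\in\mathbb Z\setminus\{0\}}\frac{|\hat g(k)|^{s'}}{|k|^{s'}}\Big)^{1/s'}.$$ $N_\varphi$ denotes the number of times $\varphi$ changes sign on $\mathbb T$, i.e. the largest $m$ for which there are cyclically ordered distinct points $x_1,\dots,x_m\in\mathbb T$ with $\varphi(x_j)\varphi(x_{j+1})<0$ for $j=1,\dots,m$, where $x_{m+1}:=x_1$. The convention $1/\infty=0$ is used. *)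

(* Defs.v *)
From HB Require Import structures.
From mathcomp Require Import all_boot all_order all_algebra.
From mathcomp Require Import all_classical all_reals all_analysis.
From mathcomp Require Export complex.

Set Implicit Arguments.
Unset Strict Implicit.
Unset Printing Implicit Defensive.
Import Order.TTheory GRing.Theory Num.Theory.
Import numFieldNormedType.Exports.

Local Open Scope classical_set_scope.
Local Open Scope ring_scope.

(* Functions on the torus R/Z are 1-periodic functions on R, written
   [periodic f 1]; integrals over the torus are integrals over the fundamental
   domain [0, 1[, that is, against the following measure on R. *)
Definition torus_measure (R : realType) : {measure set (measurableTypeR R) -> \bar R} :=
  mrestr (@lebesgue_measure R) (@measurable_itv R `[0, 1[).

(* The Hoelder conjugate as a real number. It is only used for p > 1
   (p = +oo included), where it is finite. *)
Definition conj_exp (R : realType) (p : \bar R) : R :=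
  fine (hoelder_conjugate p).

Definition torus_norm (R : realType) (p : \bar R) (f : R -> R) : \bar R :=
  Lnorm (torus_measure R) p (EFin \o f).

Definition torus_cintegrable (R : realType) (f : R -> R[i]) : Prop :=
  (torus_measure R).-integrable setT (fun x => (complex.Re (f x))%:E) /\
  (torus_measure R).-integrable setT (fun x => (complex.Im (f x))%:E).

Definition torus_cintegral (R : realType) (f : R -> R[i]) : R[i] :=
  Complex (\int[torus_measure R]_x complex.Re (f x))
          (\int[torus_measure R]_x complex.Im (f x)).

(* e^{-2 pi i k x} *)
Definition fourier_mode (R : realType) (k : int) (x : R) : R[i] :=
  Complex (cos (2 * pi * k%:~R * x)) (- sin (2 * pi * k%:~R * x)).

Definition fourier_coef (R : realType) (f : R -> R[i]) (k : int) : R[i] :=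
  torus_cintegral (fun x => f x * fourier_mode k x).

Definition seq_norm (R : realType) (t : R) (a : int -> R[i]) : \bar R :=
  poweR (\esum_(k in [set: int]) (ComplexField.Normc.normc (a k) `^ t)%:E) t^-1.

Definition fourier_lebesgue_norm (R : realType) (t : R) (g : R -> R[i]) :
    \bar R :=
  poweR (\esum_(k in [set k : int | k != 0])
     (ComplexField.Normc.normc (fourier_coef g k) `^ t / `|k%:~R| `^ t)%:E) t^-1.

(* Lifting to R, cyclically ordered distinct points x_0, ..., x_{m-1} of R/Z
   are increasing real numbers in an interval of length < 1; [ordS] is the
   cyclic successor of 'I_m. *)
Definition alternates (R : realType) (phi : R -> R) (m : nat) : Prop :=
  exists x : 'I_m -> R,
    (forall i j : 'I_m, (i < j)%N -> x i < x j < x i + 1) /\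
    (forall j : 'I_m, phi (x j) * phi (x (ordS j)) < 0).

(* The supremum is +oo if there is no largest m. *)
Definition sign_changes (R : realType) (phi : R -> R) : \bar R :=
  ereal_sup [set (m%:R)%:E | m in [set m : nat | alternates phi m]].

Variant admissible_ratio (R : realType) (s : R) (r : \bar R) :
    ((R -> R) -> \bar R) -> Prop :=
| ProductRatio (p q : \bar R) of
    (1 <= p)%E & (1 <= q)%E & (1 <= r)%E
    & (1 + (s^-1)%:E <= p^-1 + q^-1 - r^-1)%E :
    admissible_ratio s r (fun phi =>
      (torus_norm p phi * torus_norm q phi / torus_norm r phi)%E)
| PowerRatio of (1 < r)%E :
    admissible_ratio s r (fun phi =>
      (poweR (torus_norm 1%E phi) (1 + conj_exp r / s)
       / poweR (torus_norm r phi) (conj_exp r / s))%E).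

(* h and g are complex-valued; the splitting holds almost everywhere. *)
Record split_function (R : realType) (s M : R) (phi : R -> R)
    (h g : R -> R[i]) : Prop := SplitFunction {
  split_M_gt0 : 0 < M;
  split_phi_periodic : periodic phi 1;
  split_phi_continuous : continuous phi;
  split_phi_neq0 : exists x, phi x != 0;
  split_phi_mean0 : \int[torus_measure R]_x phi x = 0;
  split_phi_sign_changes : (sign_changes phi < +oo)%E;
  split_h_periodic : periodic h 1;
  split_g_periodic : periodic g 1;
  split_h_integrable : torus_cintegrable h;
  split_g_integrable : torus_cintegrable g;
  split_eq : {ae torus_measure R, forall x, Complex (phi x) 0 = h x + g x};
  split_h_low : forall k : int, 0 < `|k%:~R| :> R -> `|k%:~R| < M ->
    fourier_coef h k = 0;
  split_h_summable : (seq_norm (conj_exp s%:E) (fourier_coef h) < +oo)%E;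
  split_g_summable : (seq_norm (conj_exp s%:E) (fourier_coef g) < +oo)%E
}.

(* Main.v *)
Require Import Defs.
From mathcomp Require Import all_boot all_order all_algebra.
From mathcomp Require Import all_classical all_reals all_analysis.
From mathcomp Require Import measurable_realfun ess_sup_inf ring lra.
Import Order.TTheory GRing.Theory Num.Theory.
Import numFieldNormedType.Exports.
Local Open Scope ring_scope.

(** The quantity that controls everything is the primitive Phi of phi with zero
mean, which is again a function on the torus because phi has zero mean. Two
facts about it pull in opposite directions.

Few sign changes force Phi to be large. Between two sign changes Phi is
monotone, so on such an arc the part of the mass of phi that lies over the
level strip |Phi| < lam is the length of an interval of values of Phi and is at
most 2 lam. Summing over the arcs, the mass of phi over that strip is at most a
constant times lam N, so if lam is a small multiple of the L^1 norm of phi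
divided by N, then half of the mass of phi sits where |Phi| >= lam
([half_mass_superlevel]). By Hoelder's inequality this superlevel set cannot be
small: its measure is at least (||phi||_1 / (2 ||phi||_r)) ^ r'.

The splitting forces Phi to be small. The k-th Fourier coefficient of Phi is
that of phi divided by 2 pi i k. For h, which lives on frequencies at least M,
this division gains a factor M^-1, and for g it produces the negative-order
seminorm. Hence the l^s' norm of the coefficients of Phi is at most a multiple
of D, the denominator in the theorem ([split_coef_bound]). The Hausdorff-Young
inequality would bound the L^s norm of Phi by a multiple of D, but only the
measure of a superlevel set is needed, so the weak-type bound
|{|Phi| >= lam}| <= C (D / lam) ^ s suffices ([primitive_superlevel]). It has
an elementary proof: split the coefficients at a height tau; the large ones
give a function bounded by lam / 2, the small ones a function whose L^2 norm is
computed by orthogonality ([hausdorff_young_weak]). To compare Phi with its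
Fourier series one needs that the partial sums converge to Phi at every point
([fourier_pointwise]); for a Lipschitz function this follows from Bessel's
inequality, applied to the quotient of Phi(y) - Phi(x) by sin (pi (x - y)).

Comparing the lower and the upper bound for the measure of the superlevel set
gives the inequality for the ratio with exponents 1 + r'/s and r'/s
([power_ratio_le]). The ratio ||phi||_p ||phi||_q / ||phi||_r is never larger:
the condition on the exponents forces p, q < r, and interpolating the L^p and
L^q norms between L^1 and L^r reduces the claim to ||phi||_1 <= ||phi||_r
([product_ratio_le]). *)

Set Implicit Arguments.
Unset Strict Implicit.
Unset Printing Implicit Defensive.
Local Open Scope classical_set_scope.

(** * Integration over the torus *)

Lemma torus_measureT (R : realType) : torus_measure R setT = 1%E.
Proof.
rewrite /torus_measure /= /mrestr setTI lebesgue_measure_itv /= lte_fin ltr01.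
by rewrite -EFinB subr0.
Qed.

Lemma torus_measure_restr (R : realType) (A : set R) :
  (torus_measure R) A = (torus_measure R) (A `&` `[0, 1[).
Proof. by rewrite /torus_measure /= /mrestr -setIA setIid. Qed.

Lemma torus_ae (R : realType) (P : R -> Prop) :
  (forall x, 0 <= x < 1 -> P x) -> {ae torus_measure R, forall x, P x}.
Proof.
move=> h; exists (~` `[0, 1[); split.
- by apply: measurableC; exact: measurable_itv.
- by rewrite torus_measure_restr setICl measure0.
- move=> x /= nP xI; apply: nP; apply: h; by move: xI; rewrite in_itv.
Qed.

(** The closed interval on the right is the one of the fundamental theorem of
calculus; the added endpoint is a null set. *)
Lemma torus_integralE (R : realType) (f : R -> \bar R) :
  measurable_fun setT f ->
  (\int[torus_measure R]_x f x = \int[lebesgue_measure]_(x in `[0%R, 1%R]) f x)%E.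
Proof.
move=> mf.
rewrite -integral_itv_bndo_bndc; last exact: measurable_funTS.
have -> : (\int[torus_measure R]_x f x
           = \int[torus_measure R]_(x in `[0%R, 1%R[) f x)%E.
  rewrite [RHS]integral_mkcond.
  apply: ae_eq_integral => //.
  - by apply/(measurable_restrictT _ _).1 => //; exact: measurable_funTS.
  - by apply: torus_ae => x x01 _; rewrite patchE mem_set.
by apply: eq_measure_integral => A mA AI; rewrite /torus_measure /= /mrestr setIidl.
Qed.

Lemma torus_bounded_integrable (R : realType) (f : R -> R) (K : R) :
  measurable_fun setT f -> (forall x, 0 <= x < 1 -> `|f x| <= K) ->
  (torus_measure R).-integrable setT (EFin \o f).
Proof.
move=> mf fK; apply/integrableP; split; first exact/measurable_EFinP.
have mf' : measurable_fun setT (fun x => `|(EFin \o f) x|%E).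
  by apply/measurable_EFinP; exact: measurableT_comp.
apply: (@le_lt_trans _ _ (\int[torus_measure R]_x (cst K%:E) x)%E).
  apply: ae_ge0_le_integral => //.
  - have /fK : 0 <= (0:R) < 1 by rewrite lexx ltr01.
    by move=> /(le_trans (normr_ge0 _)) K0 x _; rewrite lee_fin.
  - by apply: torus_ae => x x01 _; rewrite lee_fin fK.
by rewrite integral_cst // torus_measureT mule1 ltry.
Qed.

Lemma continuous_normr (R : realType) (f : R -> R) :
  continuous f -> continuous (fun x => `|f x|).
Proof.
move=> cf x.
by apply: (@continuous_comp R R R f Num.norm); [exact: cf|exact: norm_continuous].
Qed.

Lemma continuous_bounded01 (R : realType) (f : R -> R) : continuous f ->
  exists K, forall x, 0 <= x <= 1 -> `|f x| <= K.
Proof.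
move=> cf.
have [|c _ hc] := @EVT_max R (fun x => `|f x|) 0 1 ler01.
  exact/continuous_subspaceT/continuous_normr.
by exists `|f c| => x x01; apply: hc; rewrite in_itv.
Qed.

Lemma torus_continuous_integrable (R : realType) (f : R -> R) :
  continuous f -> (torus_measure R).-integrable setT (EFin \o f).
Proof.
move=> cf; have [K fK] := continuous_bounded01 cf.
apply: (@torus_bounded_integrable _ _ K); first exact: continuous_measurable_fun.
by move=> x /andP[x0 x1]; rewrite fK// x0 ltW.
Qed.

Lemma torus_FTC (R : realType) (f F : R -> R) : continuous f ->
  (forall x : R, 0 <= x <= 1 -> is_derive x 1 F (f x)) ->
  \int[torus_measure R]_x f x = F 1 - F 0.
Proof.
move=> cf dF.
have cF x : 0 <= x <= 1 -> {for x, continuous F}.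
  move=> x01; apply: differentiable_continuous; apply/derivable1_diffP.
  exact: (@ex_derive _ _ _ _ _ _ _ (dF x x01)).
rewrite /Rintegral torus_integralE; last first.
  by apply/measurable_EFinP; exact: continuous_measurable_fun.
rewrite (@continuous_FTC2 R f F) ?ltr01 //.
- exact: continuous_subspaceT.
- split.
  + move=> x; rewrite in_itv /= => /andP[x0 x1].
    by apply: (@ex_derive _ _ _ _ _ _ _ (dF x _)); rewrite !ltW.
  + by apply: cvg_at_right_filter; apply: cF; rewrite lexx ler01.
  + by apply: cvg_at_left_filter; apply: cF; rewrite lexx ler01.
- move=> x; rewrite in_itv /= => /andP[x0 x1].
  by rewrite derive1E; apply: (@derive_val _ _ _ _ _ _ _ (dF x _)); rewrite !ltW.
Qed.

(** The base point -1 keeps [0, 1] in the open half-line where the integral is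
two-sidedly differentiable. *)
Lemma continuous_antiderivative (R : realType) (f : R -> R) : continuous f ->
  exists F : R -> R, forall x : R, -1 < x -> is_derive x 1 F (f x).
Proof.
move=> cf; pose F x := \int[lebesgue_measure]_(t in `[-1, x]) f t; exists F => x x1.
have [||dF <-] := @continuous_FTC1_closed R f (-1) x (x + 1) _ _ x1 (cf x).
- by rewrite ltrDl.
- apply: continuous_compact_integrable; first exact: segment_compact.
  exact: continuous_subspaceT.
- by rewrite derive1E; apply: DeriveDef.
Qed.

Lemma torus_le_Rintegral (R : realType) (f g : R -> R) :
  (torus_measure R).-integrable setT (EFin \o f) ->
  (torus_measure R).-integrable setT (EFin \o g) ->
  (forall x, 0 <= x < 1 -> f x <= g x) ->
  \int[torus_measure R]_x f x <= \int[torus_measure R]_x g x.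
Proof.
move=> fi gi fg; rewrite -subr_ge0 -RintegralB //.
rewrite /Rintegral fine_ge0 //.
have -> : (\int[torus_measure R]_x (g x - f x)%:E =
           \int[torus_measure R]_x (`|g x - f x|%:E))%E.
  have := integrableB measurableT gi fi => /integrableP[mgf _].
  apply: ae_eq_integral => //.
    by apply/measurable_EFinP; apply: measurableT_comp => //;
       exact/measurable_EFinP.
  apply: torus_ae => x x01 _; rewrite ger0_norm // subr_ge0; exact: fg.
by apply: integral_ge0 => x _; rewrite lee_fin.
Qed.

Lemma torus_eq_Rintegral (R : realType) (f g : R -> R) :
  measurable_fun setT f -> measurable_fun setT g ->
  (forall x, 0 <= x < 1 -> f x = g x) ->
  \int[torus_measure R]_x f x = \int[torus_measure R]_x g x.
Proof.
move=> mf mg fg; rewrite /Rintegral; congr fine.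
apply: ae_eq_integral => //; try exact/measurable_EFinP.
by apply: torus_ae => x x01 _; rewrite fg.
Qed.

(** * Sign changes and the variation of a primitive *)

(** The factor (-1) ^+ i * sgn prescribes the sign of every point once that of the
first one is fixed, so that extending a run on the right never changes the
condition on the points already chosen. *)
Definition alternating_run (R : realType) (phi : R -> R) (sgn : R) (n : nat)
    (b : R) : Prop :=
  exists x : nat -> R,
    [/\ forall i, (i < n)%N -> 0 <= x i < b,
        forall i, (i.+1 < n)%N -> x i < x i.+1
      & forall i, (i < n)%N -> 0 < (-1) ^+ i * sgn * phi (x i)].

Lemma alternating_runS (R : realType) (phi : R -> R) (sgn : R) n (t y b : R) :
  alternating_run phi sgn n t -> 0 <= y -> t <= y -> y < b ->
  0 < (-1) ^+ n * sgn * phi y -> alternating_run phi sgn n.+1 b.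
Proof.
move=> [x [xI xlt xs]] y0 ty yb ys.
exists (fun i => if (i < n)%N then x i else y); split=> i.
- rewrite ltnS => _; case: ifP => [/xI/andP[-> /= xt]|_]; last by rewrite y0.
  by rewrite (lt_trans xt)// (le_lt_trans ty).
- rewrite !ltnS => iln; rewrite iln; case: ifP => [/xlt //|_].
  by have /andP[_ /lt_le_trans] := xI i iln; apply.
- rewrite ltnS leq_eqVlt => /predU1P[->|iln]; first by rewrite ltnn.
  by rewrite iln; exact: xs.
Qed.

Lemma increasing_run (R : realType) (x : nat -> R) n :
  (forall i, (i.+1 < n)%N -> x i < x i.+1) ->
  forall i j, (i < j < n)%N -> x i < x j.
Proof.
move=> xlt i; elim=> [//|j IHj] /andP[]; rewrite ltnS leq_eqVlt.
move=> /predU1P[->|ij] jn; first exact: xlt.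
by apply: lt_trans (xlt j jn); apply: IHj; rewrite ij (ltnW jn).
Qed.

(** The points of a run lie strictly below its bound. Consequently the set of
bounds that admit a run of given length does not contain its infimum, which
lets [variation_le_runs] split exactly at that infimum. *)
Lemma alternating_run_open (R : realType) (phi : R -> R) (sgn : R) n (t : R) :
  alternating_run phi sgn n.+1 t ->
  exists t', [/\ 0 <= t', t' < t & alternating_run phi sgn n.+1 t'].
Proof.
move=> [x [xI xlt xs]]; have /andP[xn0 xnt] := xI n (ltnSn n).
have [xt' t't] := midf_lt xnt.
exists ((x n + t) / 2); split => //; first by rewrite ltW// (le_lt_trans xn0).
exists x; split => // i; rewrite ltnS => ilt.
have /andP[-> _] := xI i ilt => /=; apply: le_lt_trans xt'.
move: ilt; rewrite leq_eqVlt => /predU1P[->//|iltn].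
by apply/ltW/(increasing_run xlt); rewrite iltn ltnSn.
Qed.

(** With U' = w phi and V' = w |phi|, the function V - c U is constant where phi has
the sign c, so V varies by as much as U, whose oscillation is at most 2 B. *)
Lemma constant_sign_variation (R : realType) (phi w U V : R -> R) (B a b c : R) :
  (forall x : R, a <= x <= b -> is_derive x 1 U (w x * phi x)) ->
  (forall x : R, a <= x <= b -> is_derive x 1 V (w x * `|phi x|)) ->
  (forall x, `|U x| <= B) -> a <= b -> `|c| = 1 ->
  (forall x, a < x < b -> 0 <= c * phi x) ->
  V b - V a <= 2 * B.
Proof.
move=> dU dV UB; rewrite le_eqVlt => /predU1P[<- _ _|ab c1 cphi].
  by rewrite subrr mulr_ge0// (le_trans _ (UB a)).
pose F x := V x - c * U x.
have dF (x : R) : a <= x <= b -> is_derive x 1 F (w x * `|phi x| - c * (w x * phi x)).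
  move=> xab; have := dU x xab; have := dV x xab => dVx dUx.
  by apply: is_deriveB.
have [||x xab] := @MVT R F (fun x => w x * `|phi x| - c * (w x * phi x)) a b ab.
- by move=> x /[!in_itv]/= /andP[ax xb]; apply: dF; rewrite !ltW.
- apply: derivable_within_continuous => x /[!in_itv]/= xab.
  exact: (@ex_derive _ _ _ _ _ _ _ (dF x xab)).
have cx : `|phi x| = c * phi x.
  by rewrite -[LHS]mul1r -c1 -normrM ger0_norm// cphi//; move: xab; rewrite in_itv.
rewrite cx mulrCA subrr mul0r /F => /eqP; rewrite subr_eq0 => /eqP FE.
have -> : V b - V a = c * (U b - U a) by rewrite mulrBr; move: FE; lra.
apply: (le_trans (ler_norm _)); rewrite normrM c1 mul1r.
by apply: (le_trans (ler_normB _ _)); rewrite mulr2n mulrDl mul1r lerD.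
Qed.

(** Induction on the length of the forbidden run. Let t be the infimum of the bounds
that admit a run of length n.+1. Below t no such run exists and the induction
hypothesis applies; above t, a point with the sign that continues the
alternation would produce a run of length n.+2, so phi keeps a constant sign
there and the variation grows by at most 2 B. *)
Lemma variation_le_runs (R : realType) (phi w U V : R -> R) (B sgn : R) :
  `|sgn| = 1 -> (forall x, 0 <= w x) ->
  (forall x : R, 0 <= x <= 1 -> is_derive x 1 U (w x * phi x)) ->
  (forall x : R, 0 <= x <= 1 -> is_derive x 1 V (w x * `|phi x|)) ->
  (forall x, `|U x| <= B) ->
  forall n b, 0 <= b <= 1 -> ~ alternating_run phi sgn n.+1 b ->
  V b - V 0 <= 2 * B * n.+1%:R.
Proof.
move=> sgn1 w0 dU dV UB.
have sub (x y z : R) : 0 <= x -> y <= 1 -> x <= z <= y -> 0 <= z <= 1.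
  by move=> x0 y1 /andP[xz zy]; rewrite (le_trans x0 xz) (le_trans zy y1).
have sgnX n : `|(-1) ^+ n * sgn| = 1.
  by rewrite normrM sgn1 normrX normrN1 expr1n mulr1.
have piece n (a b : R) : 0 <= a -> a <= b -> b <= 1 ->
    (forall y, a < y < b -> ~ 0 < (-1) ^+ n * sgn * phi y) ->
    V b - V a <= 2 * B.
  move=> a0 ab b1 h.
  apply: (@constant_sign_variation _ phi w U V B a b (- ((-1) ^+ n * sgn))) => //.
  - by move=> x /(sub _ _ _ a0 b1); exact: dU.
  - by move=> x /(sub _ _ _ a0 b1); exact: dV.
  - by rewrite normrN.
  - by move=> x /h /negP; rewrite -leNgt mulNr oppr_ge0.
have B0 : 0 <= 2 * B by rewrite mulr_ge0// (le_trans _ (UB 0)).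
elim=> [|n IHn] b /andP[b0 b1] nrun.
  rewrite mulr1; apply: (piece 0%N) => // y /andP[y0 yb] ys; apply: nrun.
  exists (fun=> y); split=> [i _|//|i]; first by rewrite yb ltW.
  by rewrite ltnS leqn0 => /eqP ->.
have [run|nrun'] := pselect (alternating_run phi sgn n.+1 b); last first.
  apply: (le_trans (IHn b _ nrun')); rewrite ?b0//.
  by apply: ler_wpM2l => //; rewrite ler_nat.
pose S := [set t : R | 0 <= t /\ alternating_run phi sgn n.+1 t].
have S_inf : has_inf S by split; [exists b|exists 0 => t []].
have t0 : 0 <= inf S by apply: lb_le_inf; [exists b|move=> t []].
have tb : inf S <= b by apply: ge_inf; [exists 0 => t []|].
have ntS : ~ alternating_run phi sgn n.+1 (inf S).
  move=> /alternating_run_open [t' [t'0 t't rt']].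
  suff : inf S <= t' by rewrite leNgt t't.
  by apply: ge_inf; [exists 0 => t []|].
have -> : V b - V 0 = (V (inf S) - V 0) + (V b - V (inf S)) by lra.
rewrite -(natr1 n.+1) mulrDr mulr1; apply: lerD.
  by apply: IHn => //; rewrite t0 (le_trans tb).
apply: (piece n.+1) => // y /andP[ty yb] ys; apply: nrun.
have [z [z0 rz] zy] : exists2 z, S z & z < y by exact: (inf_lt S_inf.1).
by apply: (alternating_runS rz _ (ltW zy) yb ys); rewrite (le_trans t0)// ltW.
Qed.

(** The even length makes the last point and the first one have opposite signs,
which closes the run into a cyclic alternation. *)
Lemma alternating_run_alternates (R : realType) (phi : R -> R) (sgn : R) k :
  `|sgn| = 1 -> alternating_run phi sgn k.*2 1 -> alternates phi k.*2.
Proof.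
move=> sgn1 [x [xI xlt xs]].
have sq : sgn * sgn = 1.
  by rewrite -[LHS]ger0_norm -?expr2 ?sqr_ge0// normrX sgn1 expr1n.
exists (fun i : 'I_k.*2 => x i); split.
  move=> i j ij; have ij' : (i < j < k.*2)%N by rewrite ij ltn_ord.
  rewrite (increasing_run xlt ij') /=.
  have /andP[_ ] := xI j (ltn_ord j); have /andP[? _] := xI i (ltn_ord i).
  by move=> /lt_le_trans; apply; rewrite lerDr.
move=> j; have k0 : (0 < k.*2)%N := leq_ltn_trans (leq0n j) (ltn_ord j).
have /= := ltn_ord j; rewrite -[X in (_ < X)%N -> _](prednK k0) ltnS leq_eqVlt.
move=> /predU1P[jE|jlt].
  have -> : (j.+1 %% k.*2 = 0)%N by rewrite jE prednK// modnn.
  have := mulr_gt0 (xs j (ltn_ord j)) (xs 0%N k0); rewrite jE expr0.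
  have -> : (-1) ^+ k.*2.-1 = -1 :> R.
    by rewrite -signr_odd -[odd _]negbK -oddS prednK// odd_double.
  by rewrite mulN1r mul1r mulNr mulNr mulrACA sq mul1r oppr_gt0.
have jk : (j.+1 < k.*2)%N by rewrite -ltn_predRL.
have -> : (j.+1 %% k.*2 = j.+1)%N by rewrite modn_small.
have := mulr_gt0 (xs j (ltn_ord j)) (xs j.+1 jk).
rewrite exprS mulN1r !mulNr mulrN oppr_gt0 mulrACA (mulrACA _ sgn) sq mulr1.
by rewrite -expr2 sqrr_sign mul1r.
Qed.

(** Precomposing with the maximum with -1/2 extends the antiderivative
continuously, hence measurably, to the whole line without changing it near
[0, 1]. *)
Lemma continuous_primitive (R : realType) (f : R -> R) : continuous f ->
  exists2 F : R -> R, continuous F &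
    forall x : R, 0 <= x <= 1 -> is_derive x 1 F (f x).
Proof.
move=> cf; have [F dF] := continuous_antiderivative cf.
have m0 : -1 < - 2^-1 :> R by rewrite ltrN2 invf_lt1// ltr1n.
exists (fun x => F (Num.max x (- 2^-1))).
  pose m (x : R) : R := Num.max x (- 2^-1).
  have cm : continuous m.
    move=> x; apply: (@continuous_max R R id (cst (- 2^-1)) x) => //.
    exact: cst_continuous.
  move=> x; apply: (@continuous_comp R R R m F); first exact: cm.
  apply: differentiable_continuous; apply/derivable1_diffP.
  apply: (@ex_derive _ _ _ _ _ _ _ (dF _ _)).
  by rewrite (lt_le_trans m0)// le_max lexx orbT.
move=> x /andP[x0 _].
have xm : - 2^-1 < x by rewrite (lt_le_trans _ x0)// oppr_lt0 invr_gt0.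
apply: near_eq_is_derive (dF x (lt_trans m0 xm)).
near=> y; congr F; apply/esym/max_idPl/ltW; near: y.
exact: lt_nbhsr.
Unshelve. all: by end_near. Qed.

(** Without a change of sign, |phi| = c phi for a constant sign c, and the integral
of |phi| would vanish with that of phi. *)
Lemma mean_zero_alternates (R : realType) (phi : R -> R) : continuous phi ->
  \int[torus_measure R]_x phi x = 0 ->
  0 < \int[torus_measure R]_x `|phi x| -> alternates phi 2.
Proof.
move=> cphi phi0 phi_gt0; apply: contrapT => nalt.
have run (x y : R) : 0 <= x -> x < y -> y < 1 -> ~ phi x * phi y < 0.
  move=> x0 xy y1 xys; apply: nalt.
  have px : phi x != 0 by apply/eqP => px; move: xys; rewrite px mul0r ltxx.
  have sq : Num.sg (phi x) * Num.sg (phi x) = 1.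
    by case: sgrP px; rewrite ?eqxx// => _ _; rewrite ?mulrNN mulr1.
  apply: (@alternating_run_alternates R phi (Num.sg (phi x)) 1).
    by rewrite normr_sg px.
  exists (fun i => if i == 0%N then x else y); split=> [[|i]|[|i]|[|[|i]]]//= _.
  - by rewrite x0 (lt_trans xy).
  - by rewrite y1 ltW// (le_lt_trans x0).
  - by rewrite expr0 mul1r -normrEsg normr_gt0.
  - rewrite expr1 mulN1r mulNr oppr_gt0.
    rewrite -(pmulr_rlt0 _ (_ : 0 < `|phi x|)) ?normr_gt0//.
    by rewrite mulrA [`|_| * _]mulrC -numEsg.
have [c c1 cE] : exists2 c : R, c = 1 \/ c = -1 &
    forall x, 0 <= x < 1 -> `|phi x| = c * phi x.
  have [[x /andP[x0 x1] px]|npos] :=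
      pselect (exists2 x, 0 <= x < 1 & 0 < phi x).
    exists 1; first by left.
    move=> y /andP[y0 y1]; rewrite mul1r ger0_norm// leNgt; apply/negP => py.
    have [xy|yx|xy] := ltgtP x y.
    - by apply: (run x y) => //; rewrite nmulr_llt0.
    - by apply: (run y x) => //; rewrite pmulr_llt0.
    - by move: py; rewrite -xy ltNge ltW.
  exists (-1); first by right.
  move=> y yI; rewrite mulN1r ler0_norm// leNgt; apply/negP => py.
  by apply: npos; exists y.
move: phi_gt0; rewrite (torus_eq_Rintegral _ _ cE); first last.
- apply: continuous_measurable_fun => x.
  by apply: cvgM; [exact: cvg_cst|exact: cphi].
- by apply: continuous_measurable_fun; exact: continuous_normr.
rewrite RintegralZl//; last exact: torus_continuous_integrable.
by rewrite phi0 mulr0 ltxx.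
Qed.

Lemma is_derive_Ml (R : realType) (f : R -> R) (c x d : R) :
  is_derive x 1 f d -> is_derive x 1 (fun y => c * f y) (c * d).
Proof. by move=> df; exact: (is_deriveZ c df). Qed.

(** The weight w = 1 / (1 + (Phi / lam)^2) is a smooth substitute for the indicator
of |Phi| < lam. It is chosen because w phi has an explicit bounded primitive,
lam * atan (Phi / lam), so that the variation of that primitive, and hence the
weighted mass of phi, is controlled by the number of sign changes. *)
Lemma mass_where_primitive_small (R : realType) (phi Phi : R -> R) (lam N : R) :
  continuous phi -> continuous Phi ->
  (forall x : R, 0 <= x <= 1 -> is_derive x 1 Phi (phi x)) ->
  \int[torus_measure R]_x phi x = 0 ->
  0 < \int[torus_measure R]_x `|phi x| -> 0 < lam ->
  sign_changes phi = N%:E ->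
  \int[torus_measure R]_x ((1 + (Phi x / lam) ^+ 2)^-1 * `|phi x|)
    <= 2 * pi * lam * N.
Proof.
move=> cphi cPhi dPhi phi0 phi_gt0 lam0 NE.
pose w x := (1 + (Phi x / lam) ^+ 2)^-1.
have w_gt0 x : 0 < 1 + (Phi x / lam) ^+ 2 by rewrite ltr_pwDl// sqr_ge0.
have le_N m : alternates phi m -> m%:R <= N.
  by move=> am; rewrite -lee_fin -NE; apply: ereal_sup_ubound; exists m.
have N2 : 2 <= N by apply: (le_N 2%N); exact: mean_zero_alternates.
have cw : continuous w.
  move=> x; apply: cvgV; first by rewrite gt_eqF.
  apply: cvgD; first exact: cvg_cst.
  have cP : {for x, continuous (fun y => Phi y / lam)}.
    by apply: cvgM; [exact: cPhi|exact: cvg_cst].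
  by under eq_fun do rewrite expr2; apply: cvgM.
pose U x := lam * atan (Phi x / lam).
have dU (x : R) : 0 <= x <= 1 -> is_derive x 1 U (w x * phi x).
  move=> x01; have dPx := dPhi x x01.
  have d1 : is_derive x 1 (fun y => Phi y / lam) (phi x / lam).
    by rewrite mulrC; under eq_fun do rewrite mulrC; exact: is_derive_Ml.
  have d2 := @is_derive1_comp R (@atan R) _ _ _ _ (is_derive1_atan _) d1.
  apply: (is_derive_eq (is_derive_Ml lam d2)).
  by rewrite mulrCA; congr (_ * _); rewrite mulrCA divff ?mulr1// gt_eqF.
have U_le x : `|U x| <= lam * (pi / 2).
  rewrite normrM (gtr0_norm lam0); apply: ler_wpM2l; first exact: ltW.
  by rewrite ler_norml ltW ?atan_gtNpi2//= ltW// atan_ltpi2.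
have cwphi : continuous (fun x => w x * `|phi x|).
  move=> x; apply: cvgM; first exact: cw.
  exact: (continuous_normr cphi).
have [V cV dV] := continuous_primitive cwphi.
rewrite (torus_FTC cwphi dV).
pose k := (Num.Def.trunc (N / 2)).+1.
have N0 : 0 <= N / 2 by rewrite divr_ge0// (le_trans _ N2).
have /andP[kl ku] := truncn_itv N0.
(* k.*2 is the least even number greater than N, so it is at most N + 2 <= 2 N. *)
have nk : ~ alternating_run phi 1 k.*2.-1.+1 1.
  rewrite prednK ?double_gt0// => run.
  have /le_N := alternating_run_alternates (normr1 _) run.
  rewrite leNgt -muln2 natrM => /negP; apply.
  by rewrite -ltr_pdivrMr.
have := variation_le_runs (normr1 _) _ dU dV U_le _ nk.
rewrite prednK// => /(_ _ _)/le_trans; apply => //.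
- by move=> x; rewrite invr_ge0 ltW.
- by rewrite ler01 lexx.
rewrite (_ : 2 * (lam * (pi / 2)) = pi * lam); last by field.
rewrite -[_ * lam * N]mulrA -mulrA [_ * pi]mulrC -mulrA.
apply: ler_wpM2l; rewrite ?pi_ge0// [leRHS]mulrCA; apply: ler_wpM2l; first exact: ltW.
have : (Num.Def.trunc (N / 2))%:R * 2 <= N by rewrite -ler_pdivlMr.
rewrite -muln2 natrM -(natr1 (Num.Def.trunc (N / 2))).
by move: N2; lra.
Qed.

(** * Orthogonal systems of bounded functions *)

(** Bounds are only required on [0, 1[: some functions used below, such as the
quotient in [fourier_pointwise], are not periodic and unbounded elsewhere. *)
Definition torus_bounded (R : realType) (f : R -> R) : Prop :=
  measurable_fun setT f /\ exists K, forall x, 0 <= x < 1 -> `|f x| <= K.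

Lemma torus_bounded_int (R : realType) (f : R -> R) : torus_bounded f ->
  (torus_measure R).-integrable setT (EFin \o f).
Proof. by case=> mf [K fK]; exact: (torus_bounded_integrable mf fK). Qed.

Lemma torus_bounded_continuous (R : realType) (f : R -> R) :
  continuous f -> torus_bounded f.
Proof.
move=> cf; split; first exact: continuous_measurable_fun.
by have [K fK] := continuous_bounded01 cf; exists K => x /andP[x0 /ltW x1];
  rewrite fK ?x0.
Qed.

Lemma torus_bounded_cst (R : realType) (c : R) : torus_bounded (fun=> c).
Proof. by split; [exact: measurable_cst|exists `|c|]. Qed.

Lemma torus_boundedD (R : realType) (f g : R -> R) :
  torus_bounded f -> torus_bounded g -> torus_bounded (fun x => f x + g x).
Proof.
move=> [mf [K fK]] [mg [L gL]]; split; first exact: measurable_funD.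
by exists (K + L) => x xI; rewrite (le_trans (ler_normD _ _))// lerD ?fK ?gL.
Qed.

Lemma torus_boundedM (R : realType) (f g : R -> R) :
  torus_bounded f -> torus_bounded g -> torus_bounded (fun x => f x * g x).
Proof.
move=> [mf [K fK]] [mg [L gL]]; split; first exact: measurable_funM.
by exists (K * L) => x xI; rewrite normrM ler_pM ?fK ?gL.
Qed.

Lemma torus_boundedB (R : realType) (f g : R -> R) :
  torus_bounded f -> torus_bounded g -> torus_bounded (fun x => f x - g x).
Proof.
move=> [mf [K fK]] [mg [L gL]]; split; first exact: measurable_funB.
by exists (K + L) => x xI; rewrite (le_trans (ler_normB _ _))// lerD ?fK ?gL.
Qed.

Lemma torus_bounded_sum (R : realType) (I : Type) (r : seq I) (P : pred I)
    (f : I -> R -> R) : (forall i, torus_bounded (f i)) ->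
  torus_bounded (fun x => \sum_(i <- r | P i) f i x).
Proof.
move=> fb; elim: r => [|i r IHr].
  by under eq_fun do rewrite big_nil; exact: torus_bounded_cst.
under eq_fun do rewrite big_cons; case: (P i) => //.
exact: torus_boundedD.
Qed.

Lemma torus_integral_sum (R : realType) (I : Type) (r : seq I) (P : pred I)
    (f : I -> R -> R) : (forall i, torus_bounded (f i)) ->
  \int[torus_measure R]_x (\sum_(i <- r | P i) f i x)
  = \sum_(i <- r | P i) \int[torus_measure R]_x f i x.
Proof.
move=> fb; elim: r => [|i r IHr].
  by under eq_Rintegral do rewrite big_nil; rewrite big_nil Rintegral_cst// mul0r.
under eq_Rintegral do rewrite big_cons; rewrite big_cons; case: (P i) => //.
rewrite -IHr RintegralD//; first exact: torus_bounded_int.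
by apply: torus_bounded_int; exact: torus_bounded_sum.
Qed.

Lemma torus_integralZ (R : realType) (c : R) (f : R -> R) : torus_bounded f ->
  \int[torus_measure R]_x (c * f x) = c * \int[torus_measure R]_x f x.
Proof. by move=> /torus_bounded_int fb; rewrite RintegralZl. Qed.

Lemma torus_integralD (R : realType) (f g : R -> R) :
  torus_bounded f -> torus_bounded g ->
  \int[torus_measure R]_x (f x + g x)
  = \int[torus_measure R]_x f x + \int[torus_measure R]_x g x.
Proof. by move=> /torus_bounded_int fb /torus_bounded_int gb; rewrite RintegralD. Qed.

Lemma torus_integralB (R : realType) (f g : R -> R) :
  torus_bounded f -> torus_bounded g ->
  \int[torus_measure R]_x (f x - g x)
  = \int[torus_measure R]_x f x - \int[torus_measure R]_x g x.
Proof. by move=> /torus_bounded_int fb /torus_bounded_int gb; rewrite RintegralB. Qed.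

Lemma torus_orthogonal_sum (R : realType) (n : nat) (P : pred nat)
    (e : nat -> R -> R) (kappa : nat -> R) : (forall i, torus_bounded (e i)) ->
  (forall i j, \int[torus_measure R]_x (e i x * e j x) = (i == j)%:R * kappa i) ->
  \int[torus_measure R]_x (\sum_(i < n | P i) e i x) ^+ 2
  = \sum_(i < n | P i) kappa i.
Proof.
move=> eb eo.
under eq_Rintegral.
  move=> x _; rewrite expr2 mulr_suml.
  under eq_bigr do rewrite mulr_sumr.
  over.
rewrite torus_integral_sum; last first.
  by move=> i; apply: torus_bounded_sum => j; exact: torus_boundedM.
apply: eq_bigr => i Pi; rewrite torus_integral_sum; last first.
  by move=> j; exact: torus_boundedM.
rewrite (bigD1 i)//= eo eqxx mul1r big1 ?addr0// => j /andP[_ ji].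
by rewrite eo (_ : (_ == _) = false) ?mul0r//; apply/negbTE; rewrite eq_sym.
Qed.

(** Expand the integral of (f - p)^2 >= 0, where p is the projection of f on the
span of the e_i. *)
Lemma bessel (R : realType) (f : R -> R) (e : nat -> R -> R) (kappa : R) n :
  torus_bounded f -> (forall i, torus_bounded (e i)) -> 0 < kappa ->
  (forall i j, \int[torus_measure R]_x (e i x * e j x) = (i == j)%:R * kappa) ->
  \sum_(i < n) (\int[torus_measure R]_x (f x * e i x)) ^+ 2
  <= kappa * \int[torus_measure R]_x (f x ^+ 2).
Proof.
move=> fb eb k0 eo; pose c i := kappa^-1 * \int[torus_measure R]_x (f x * e i x).
pose p x := \sum_(i < n) c i * e i x.
have ceb i : torus_bounded (fun x => c i * e i x).
  by apply: torus_boundedM => //; exact: torus_bounded_cst.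
have pb : torus_bounded p by exact: torus_bounded_sum.
have p2 : \int[torus_measure R]_x (p x ^+ 2) = \sum_(i < n) c i ^+ 2 * kappa.
  rewrite (@torus_orthogonal_sum _ n xpredT (fun i x => c i * e i x)
    (fun i => c i ^+ 2 * kappa))//.
  move=> i j; under eq_Rintegral do rewrite mulrACA.
  rewrite torus_integralZ; last exact: torus_boundedM.
  by rewrite eo; case: eqP => [->|]; rewrite ?mul1r ?mul0r ?mulr0// expr2.
have fp : \int[torus_measure R]_x (f x * p x) = \sum_(i < n) c i ^+ 2 * kappa.
  under eq_Rintegral do rewrite mulr_sumr.
  rewrite torus_integral_sum => [|i]; last exact: torus_boundedM.
  apply: eq_bigr => i _; under eq_Rintegral do rewrite mulrCA.
  rewrite torus_integralZ; last exact: torus_boundedM.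
  by rewrite expr2 -mulrA; congr (_ * _); rewrite /c mulrC mulrA divff ?mul1r// gt_eqF.
have fE : \sum_(i < n) (\int[torus_measure R]_x (f x * e i x)) ^+ 2
    = kappa * \sum_(i < n) c i ^+ 2 * kappa.
  rewrite mulr_sumr; apply: eq_bigr => i _.
  by rewrite /c exprMn; field; rewrite gt_eqF.
rewrite fE; apply: ler_wpM2l; first exact: ltW.
have : 0 <= \int[torus_measure R]_x ((f x - p x) ^+ 2).
  by apply: Rintegral_ge0 => x _; exact: sqr_ge0.
have -> : \int[torus_measure R]_x ((f x - p x) ^+ 2) =
   \int[torus_measure R]_x ((f x * f x - 2 * (f x * p x)) + p x ^+ 2).
  by apply: eq_Rintegral => x _; ring.
have ffb := torus_boundedM fb fb; have fpb := torus_boundedM fb pb.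
have fpb2 := torus_boundedM (torus_bounded_cst 2) fpb.
rewrite torus_integralD; last 2 first.
- exact: torus_boundedB.
- exact: torus_boundedM.
rewrite torus_integralB// torus_integralZ// p2 fp.
have -> : \int[torus_measure R]_x (f x ^+ 2) = \int[torus_measure R]_x (f x * f x).
  by apply: eq_Rintegral => x _; rewrite expr2.
by set a := Rintegral _ _ _; set b := \sum_(i < n) _; lra.
Qed.

(** * Trigonometric integrals *)

Lemma continuous_affine (R : realType) (a b : R) : continuous (fun x : R => a * x + b).
Proof.
move=> x; apply: cvgD; last exact: cvg_cst.
by apply: cvgM; [exact: cvg_cst|exact: cvg_id].
Qed.

Lemma continuous_cos_affine (R : realType) (a b : R) :
  continuous (fun x : R => cos (a * x + b)).
Proof.
move=> x; apply: (@continuous_comp R R R (fun x => a * x + b) cos).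
  exact: continuous_affine.
exact: continuous_cos.
Qed.

Lemma continuous_sin_affine (R : realType) (a b : R) :
  continuous (fun x : R => sin (a * x + b)).
Proof.
move=> x; apply: (@continuous_comp R R R (fun x => a * x + b) sin).
  exact: continuous_affine.
exact: continuous_sin.
Qed.

Lemma is_derive_affine (R : realType) (a b x : R) :
  is_derive x 1 (fun y : R => a * y + b) a.
Proof.
have h : is_derive x 1 (fun y : R => a * y) (a * 1) := is_derive_Ml a (is_derive_id x 1).
by apply: (is_derive_eq (is_deriveD h (is_derive_cst b x 1))); rewrite addr0 mulr1.
Qed.

Lemma is_derive_sin_affine (R : realType) (a b x : R) :
  is_derive x 1 (fun y : R => sin (a * y + b)) (a * cos (a * x + b)).
Proof.
rewrite mulrC; apply: (@is_derive1_comp R (@sin R)).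
exact: is_derive_affine.
Qed.

Lemma is_derive_cos_affine (R : realType) (a b x : R) :
  is_derive x 1 (fun y : R => cos (a * y + b)) (- (a * sin (a * x + b))).
Proof.
rewrite -mulrN mulrC; apply: (@is_derive1_comp R (@cos R)).
exact: is_derive_affine.
Qed.

Lemma continuous_cosM (R : realType) (a : R) : continuous (fun x : R => cos (a * x)).
Proof.
by move=> x; have := @continuous_cos_affine R a 0 x; under eq_fun do rewrite addr0.
Qed.

Lemma continuous_sinM (R : realType) (a : R) : continuous (fun x : R => sin (a * x)).
Proof.
by move=> x; have := @continuous_sin_affine R a 0 x; under eq_fun do rewrite addr0.
Qed.

Lemma is_derive_sinM (R : realType) (a x : R) :
  is_derive x 1 (fun y : R => sin (a * y)) (a * cos (a * x)).
Proof.
by have := is_derive_sin_affine a 0 x; under eq_fun do rewrite addr0; rewrite addr0.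
Qed.

Lemma is_derive_cosM (R : realType) (a x : R) :
  is_derive x 1 (fun y : R => cos (a * y)) (- (a * sin (a * x))).
Proof.
by have := is_derive_cos_affine a 0 x; under eq_fun do rewrite addr0; rewrite addr0.
Qed.

Lemma sinD2pin (R : realType) (n : nat) (x : R) : sin (2 * pi * n%:R + x) = sin x.
Proof.
elim: n => [|n IHn]; first by rewrite mulr0 add0r.
have -> : 2 * pi * n.+1%:R + x = (2 * pi * n%:R + x) + pi *+ 2.
  by rewrite -natr1 mulr2n; ring.
by rewrite sinD2pi.
Qed.

Lemma cosD2pin (R : realType) (n : nat) (x : R) : cos (2 * pi * n%:R + x) = cos x.
Proof. by rewrite -!sinDpihalf -addrA sinD2pin. Qed.

Lemma torus_integral_cos (R : realType) (n : nat) (c : R) : (0 < n)%N ->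
  \int[torus_measure R]_x cos (2 * pi * n%:R * x + c) = 0.
Proof.
move=> n0; pose a : R := 2 * pi * n%:R.
have a0 : a != 0 by rewrite gt_eqF// !mulr_gt0 ?pi_gt0 ?ltr0n.
have dF (x : R) : 0 <= x <= 1 ->
    is_derive x 1 (fun x => a^-1 * sin (a * x + c)) (cos (a * x + c)).
  move=> _; apply: (is_derive_eq (is_derive_Ml a^-1 (is_derive_sin_affine a c x))).
  by rewrite mulrA mulVf// mul1r.
rewrite (torus_FTC (@continuous_cos_affine R a c) dF).
by rewrite mulr1 mulr0 add0r sinD2pin subrr.
Qed.

Lemma cosMcos (R : realType) (x y : R) :
  cos x * cos y = 2^-1 * cos (x - y) + 2^-1 * cos (x + y).
Proof. by rewrite cosB cosD; field. Qed.

(** Free phases c and d let this one formula cover cosines and, with a phase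
-pi / 2, sines. *)
Lemma torus_integral_cosMcos (R : realType) (m n : nat) (c d : R) :
  (0 < m)%N -> (0 < n)%N ->
  \int[torus_measure R]_x
     (cos (2 * pi * m%:R * x + c) * cos (2 * pi * n%:R * x + d))
  = (m == n)%:R * (2^-1 * cos (c - d)).
Proof.
wlog nm : m n c d / (n <= m)%N.
  move=> h m0 n0; have [nm|/ltnW mn] := leqP n m; first exact: h.
  under eq_Rintegral do rewrite mulrC.
  by rewrite h// eq_sym -[in RHS]cosN opprB.
move=> m0 n0.
have cb a b : torus_bounded (fun x : R => 2^-1 * cos (a * x + b)).
  apply: torus_boundedM; first exact: torus_bounded_cst.
  by apply: torus_bounded_continuous; exact: continuous_cos_affine.
have -> : \int[torus_measure R]_x
     (cos (2 * pi * m%:R * x + c) * cos (2 * pi * n%:R * x + d)) =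
   \int[torus_measure R]_x
     (2^-1 * cos (2 * pi * (m - n)%:R * x + (c - d)) +
      2^-1 * cos (2 * pi * (m + n)%:R * x + (c + d))).
  apply: eq_Rintegral => x _; rewrite cosMcos natrD natrB//.
  by congr (_ * cos _ + _ * cos _); ring.
rewrite torus_integralD// !torus_integralZ; try
  by apply: torus_bounded_continuous; exact: continuous_cos_affine.
rewrite [X in _ + _ * X]torus_integral_cos ?addn_gt0 ?m0// mulr0 addr0.
have [->|mn] := eqVneq m n.
  under eq_Rintegral do rewrite subnn mulr0 mul0r add0r.
  by rewrite Rintegral_cst// torus_measureT /= mulr1 mul1r.
by rewrite torus_integral_cos ?mulr0 ?mul0r// subn_gt0 ltn_neqAle eq_sym mn.
Qed.

Lemma le_mulr_cos_sin (R : realType) (x : R) : 0 <= x <= pi -> x * cos x <= sin x.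
Proof.
move=> /andP[x0 xpi]; rewrite -subr_ge0.
pose f (x : R) := sin x - x * cos x.
have df (y : R) : is_derive y 1 f (y * sin y).
  have h1 := is_deriveM (is_derive_id y 1) (is_derive_cos y).
  apply: (is_derive_eq (is_deriveB (is_derive_sin y) h1)).
  by rewrite /GRing.scale/=; ring.
have [|c] := @MVT_segment R f (fun y => y * sin y) 0 x x0 (fun y _ => df y).
  apply: derivable_within_continuous => y _.
  exact: (@ex_derive _ _ _ _ _ _ _ (df y)).
rewrite in_itv/= => /andP[c0 cx].
rewrite {1}/f {1}/f sin0 mul0r !subr0 => ->.
by rewrite !mulr_ge0// sin_ge0_pi// c0 (le_trans cx).
Qed.

(** A crude form of Jordan's inequality, which is enough to bound a difference
quotient: where cos x >= 1/2 it follows from x cos x <= sin x, and elsewhere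
sin x >= 1/2 while x <= 2. *)
Lemma sin_ge_quarter (R : realType) (x : R) : 0 <= x <= pi / 2 -> x / 4 <= sin x.
Proof.
move=> /andP[x0 x1]; have [/andP[_ pi2] _] := pihalf_02_cos_pihalf R.
have xpi : x <= pi by apply: (le_trans x1); have := pi_ge0 R; lra.
have [c12|c12] := leP (2^-1) (cos x).
  apply: le_trans (le_mulr_cos_sin (_ : 0 <= x <= pi)); last by rewrite x0.
  by apply: ler_wpM2l => //; apply: le_trans c12; lra.
have s0 : 0 <= sin x by rewrite sin_ge0_pi// x0.
have c0 : 0 <= cos x.
  by rewrite cos_ge0_pihalf// x1 (le_trans _ x0)// oppr_le0 divr_ge0// pi_ge0.
have := cos2Dsin2 x; have xx := le_trans x1 pi2.
nra.
Qed.

(** * Pointwise convergence of Fourier series *)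

Lemma lipschitz01 (R : realType) (f F : R -> R) (L : R) :
  (forall x : R, 0 <= x <= 1 -> is_derive x 1 F (f x)) ->
  (forall x, 0 <= x <= 1 -> `|f x| <= L) ->
  forall x y, 0 <= x -> x <= y -> y <= 1 -> `|F y - F x| <= L * (y - x).
Proof.
move=> dF fL x y x0 xy y1.
have sub z : z \in `[x, y]%R -> 0 <= z <= 1.
  by rewrite in_itv/= => /andP[xz zy]; rewrite (le_trans x0)// (le_trans zy).
have [||c /sub cI ->] := @MVT_segment R F f x y xy.
- by move=> z /subset_itv_oo_cc /sub; exact: dF.
- apply: derivable_within_continuous => z /sub zI.
  exact: (@ex_derive _ _ _ _ _ _ _ (dF z zI)).
by rewrite normrM (ger0_norm (_ : 0 <= y - x)) ?subr_ge0// ler_wpM2r ?subr_ge0// fL.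
Qed.

Lemma le_sin_pi (R : realType) (u : R) : 0 <= u <= 2^-1 -> u <= 2 * sin (pi * u).
Proof.
move=> /andP[u0 u1].
have := @sin_ge_quarter R (pi * u); rewrite mulr_ge0 ?pi_ge0//=.
rewrite ler_wpM2l ?pi_ge0// => /(_ isT); have := pi_ge2 R; nra.
Qed.

(** When x and y are more than half a period apart, the increment of F is estimated
along the complementary arc, through F 0 = F 1; |sin (pi (x - y))| is comparable
to the distance of x and y on the torus. *)
Lemma lipschitz_torus (R : realType) (f F : R -> R) (L : R) :
  (forall x : R, 0 <= x <= 1 -> is_derive x 1 F (f x)) ->
  (forall x, 0 <= x <= 1 -> `|f x| <= L) -> F 0 = F 1 ->
  forall x y, 0 <= x <= 1 -> 0 <= y <= 1 ->
    `|F y - F x| <= 2 * L * `|sin (pi * (x - y))|.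
Proof.
move=> dF fL F01 x y; wlog xy : x y / x <= y.
  move=> h xI yI; have [xy|/ltW yx] := leP x y; first exact: h.
  by rewrite distrC -[in leRHS]opprB mulrN sinN normrN; exact: h.
move=> /andP[x0 x1] /andP[y0 y1].
have L0 : 0 <= L by rewrite (le_trans (normr_ge0 (f 0)))// fL// lexx ler01.
rewrite -[x - y]opprB mulrN sinN normrN -mulrA mulrCA.
have [yx|yx] := leP (y - x) 2^-1.
  apply: (le_trans (lipschitz01 dF fL x0 xy y1)); apply: ler_wpM2l => //.
  apply: le_trans (@le_sin_pi R (y - x) _) _; first by rewrite subr_ge0 xy.
  by rewrite ler_pM2l// ler_norm.
have -> : `|sin (pi * (y - x))| = `|sin (pi * (1 - (y - x)))|.
  by rewrite [in RHS]mulrBr mulr1 sinB sinpi cospi mul0r sub0r mulN1r opprK.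
apply: (@le_trans _ _ (L * (1 - (y - x)))); last first.
  apply: ler_wpM2l => //; apply: le_trans (@le_sin_pi R (1 - (y - x)) _) _; last first.
    by rewrite ler_pM2l// ler_norm.
  by apply/andP; split; lra.
have -> : F y - F x = (F y - F 1) + (F 0 - F x) by rewrite F01; ring.
have h1 := lipschitz01 dF fL (lexx 0) x0 x1.
have h2 := lipschitz01 dF fL y0 y1 (lexx 1).
apply: (le_trans (ler_normD _ _)); rewrite distrC [`|F 0 - _|]distrC.
apply: (le_trans (lerD h2 h1)); rewrite -mulrDr; apply: ler_wpM2l => //; lra.
Qed.

Lemma sinMsin (R : realType) (x y : R) :
  sin x * sin y = 2^-1 * cos (x - y) - 2^-1 * cos (x + y).
Proof. by rewrite cosB cosD; field. Qed.

(** Telescoping: 2 cos (2 pi k t) sin (pi t) is the difference of consecutive sines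
of odd multiples of pi t. *)
Lemma dirichlet_kernel (R : realType) n (t : R) :
  sin (pi * t) * (1 + 2 * \sum_(i < n) cos (2 * pi * i.+1%:R * t))
  = sin ((2 * n%:R + 1) * pi * t).
Proof.
elim: n => [|n IHn]; first by rewrite big_ord0 !mulr0 addr0 mulr1 add0r mul1r.
rewrite big_ord_recr/= [2 * (_ + _)]mulrDr addrA [LHS]mulrDr IHn.
have -> : (2 * n.+1%:R + 1) * pi * t = 2 * pi * n.+1%:R * t + pi * t by ring.
have -> : (2 * n%:R + 1) * pi * t = 2 * pi * n.+1%:R * t - pi * t.
  by rewrite -natr1; ring.
by rewrite sinB sinD; ring.
Qed.

(** The functions sin ((2 i + 1) pi (x - y)) are antiperiodic, but products of two of
them are periodic, so they still form an orthogonal system. *)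
Lemma torus_integral_odd_sin (R : realType) (x : R) (i j : nat) :
  \int[torus_measure R]_y
     (sin ((2 * i%:R + 1) * pi * (x - y)) * sin ((2 * j%:R + 1) * pi * (x - y)))
  = (i == j)%:R * 2^-1.
Proof.
wlog ji : i j / (j <= i)%N.
  move=> h; have [/h//|/ltnW ij] := leqP j i.
  by under eq_Rintegral do rewrite mulrC; rewrite h// eq_sym.
have cb a b : torus_bounded (fun x : R => 2^-1 * cos (a * x + b)).
  apply: torus_boundedM; first exact: torus_bounded_cst.
  by apply: torus_bounded_continuous; exact: continuous_cos_affine.
under eq_Rintegral.
  move=> y _; rewrite sinMsin.
  have -> : (2 * i%:R + 1) * pi * (x - y) - (2 * j%:R + 1) * pi * (x - y) =
     - (2 * pi * (i - j)%:R * y + - (2 * pi * (i - j)%:R * x)).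
    by rewrite natrB//; ring.
  have -> : (2 * i%:R + 1) * pi * (x - y) + (2 * j%:R + 1) * pi * (x - y) =
     - (2 * pi * (i + j).+1%:R * y + - (2 * pi * (i + j).+1%:R * x)).
    by rewrite -(natr1 (i + j)) natrD; ring.
  rewrite !cosN.
  over.
rewrite torus_integralB// !torus_integralZ; try
  by apply: torus_bounded_continuous; exact: continuous_cos_affine.
rewrite [X in _ - _ * X]torus_integral_cos// mulr0 subr0.
have [->|ij] := eqVneq i j.
  under eq_Rintegral do rewrite subnn mulr0 !mul0r oppr0 addr0 cos0.
  by rewrite Rintegral_cst// torus_measureT /= !mulr1 mul1r.
by rewrite torus_integral_cos ?mulr0 ?mul0r// subn_gt0 ltn_neqAle eq_sym ij.
Qed.

(** Writing y^-1 as y * (y^2)^-1 reduces the inverse to a real power of a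
nonnegative function; at a zero both sides vanish. *)
Lemma measurable_funV_real (R : realType) (f : R -> R) :
  measurable_fun setT f -> measurable_fun setT (fun x => (f x)^-1).
Proof.
move=> mf.
have -> : (fun x => (f x)^-1) = (fun x => f x * powR (f x ^+ 2) (-1)).
  apply/funext => x; rewrite powR_inv1 ?sqr_ge0//.
  have [->|fx] := eqVneq (f x) 0; first by rewrite invr0 mul0r.
  by rewrite expr2 invfM mulrA divff// mul1r.
apply: measurable_funM => //.
apply: (@measurableT_comp _ _ _ _ _ _ (fun y : R => powR y (-1))) => //.
exact: measurable_funX.
Qed.

(** Multiplying and dividing by sin (pi (x - y)) turns the error at x of the n-th
partial sum into the coefficient of the bounded function
G y = (Phi y - Phi x) / sin (pi (x - y)) along the n-th element of an orthogonal
system, and Bessel's inequality makes these coefficients tend to 0. *)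
Lemma fourier_pointwise (R : realType) (phi Phi : R -> R) (x : R) :
  continuous phi -> continuous Phi ->
  (forall x : R, 0 <= x <= 1 -> is_derive x 1 Phi (phi x)) ->
  Phi 0 = Phi 1 -> \int[torus_measure R]_y Phi y = 0 -> 0 <= x <= 1 ->
  (fun n => \sum_(i < n) 2 *
    \int[torus_measure R]_y (Phi y * cos (2 * pi * i.+1%:R * (x - y))))
  @ \oo --> Phi x.
Proof.
move=> cphi cPhi dPhi Phi01 Phi0 xI.
have [L phiL] := continuous_bounded01 cphi.
pose G y := (Phi y - Phi x) / sin (pi * (x - y)).
pose e n y := sin ((2 * n%:R + 1) * pi * (x - y)).
have csin a : continuous (fun y => sin (a * (x - y))).
  by under eq_fun do rewrite mulrBr addrC -mulNr; exact: continuous_sin_affine.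
have ccos a : continuous (fun y => cos (a * (x - y))).
  by under eq_fun do rewrite mulrBr addrC -mulNr; exact: continuous_cos_affine.
have eb n : torus_bounded (e n) by apply: torus_bounded_continuous; exact: csin.
have Phib : torus_bounded Phi by exact: torus_bounded_continuous.
have Gb : torus_bounded G.
  split.
    apply: measurable_funM.
      by apply: measurable_funB => //; exact: continuous_measurable_fun.
    by apply: measurable_funV_real; apply: continuous_measurable_fun; exact: csin.
  exists (2 * L) => y /andP[y0 /ltW y1].
  have := lipschitz_torus dPhi phiL Phi01 xI (_ : 0 <= y <= 1).
  rewrite y0 y1 /G normrM normfV => /(_ isT).
  have [->|s0] := eqVneq (sin (pi * (x - y))) 0.
    rewrite normr0 invr0 !mulr0 => _.
    by rewrite mulr_ge0// (le_trans (normr_ge0 (phi 0)))// phiL// lexx ler01.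
  by rewrite ler_pdivrMr// normr_gt0.
have Sn n : \sum_(i < n) 2 *
    \int[torus_measure R]_y (Phi y * cos (2 * pi * i.+1%:R * (x - y)))
   = Phi x + \int[torus_measure R]_y (G y * e n y).
  pose K y := \sum_(i < n) cos (2 * pi * i.+1%:R * (x - y)).
  have cosb a : torus_bounded (fun y => cos (a * (x - y))).
    exact: torus_bounded_continuous.
  have Kb : torus_bounded K by exact: torus_bounded_sum.
  have KPb := torus_boundedM (torus_bounded_cst 2) Kb.
  have -> : \int[torus_measure R]_y (G y * e n y) =
     \int[torus_measure R]_y ((Phi y - Phi x) * (1 + 2 * K y)).
    apply: torus_eq_Rintegral.
    - exact: (torus_boundedM Gb (eb n)).1.
    - apply: (torus_boundedM _ _).1.
        by apply: torus_boundedB => //; exact: torus_bounded_cst.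
      by apply: torus_boundedD => //; exact: torus_bounded_cst.
    - move=> y /andP[y0 /ltW y1]; rewrite /e -dirichlet_kernel -/(K y) /G.
      have [s0|s0] := eqVneq (sin (pi * (x - y))) 0; last first.
        by rewrite mulrA divfK.
      have := lipschitz_torus dPhi phiL Phi01 xI (_ : 0 <= y <= 1).
      rewrite y0 y1 s0 normr0 mulr0 normr_le0 => /(_ isT)/eqP ->.
      by rewrite !mul0r.
  have -> : \int[torus_measure R]_y ((Phi y - Phi x) * (1 + 2 * K y)) =
     \int[torus_measure R]_y ((Phi y + 2 * (Phi y * K y)) - (Phi x + 2 * (Phi x * K y))).
    by apply: eq_Rintegral => y _; ring.
  have K0 : \int[torus_measure R]_y K y = 0.
    rewrite torus_integral_sum => [|i]; last exact: cosb.
    rewrite big1// => i _.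
    rewrite -[RHS](@torus_integral_cos R i.+1 (- (2 * pi * i.+1%:R * x)))//.
    by apply: eq_Rintegral => y _; rewrite -[in LHS]cosN; congr cos; ring.
  have PKb := torus_boundedM Phib Kb.
  have PxKb := torus_boundedM (torus_bounded_cst (Phi x)) Kb.
  rewrite torus_integralB; last 2 first.
  - by apply: torus_boundedD => //; apply: torus_boundedM => //; exact: torus_bounded_cst.
  - by apply: torus_boundedD; [|apply: torus_boundedM => //]; exact: torus_bounded_cst.
  rewrite !torus_integralD//; try exact: torus_bounded_cst; try
    by apply: torus_boundedM => //; exact: torus_bounded_cst.
  rewrite !torus_integralZ// K0 Phi0 Rintegral_cst// torus_measureT/=.
  rewrite add0r !mulr0 addr0 mulr1 addrCA subrr addr0.
  under eq_Rintegral do rewrite mulr_sumr.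
  rewrite torus_integral_sum => [|i]; last exact: torus_boundedM.
  by rewrite mulr_sumr.
rewrite (funext Sn) -[X in _ --> X]addr0; apply: cvgD; first exact: cvg_cst.
pose u n := \int[torus_measure R]_y (G y * e n y).
have u2 : (fun n => u n ^+ 2) @ \oo --> 0.
  apply: cvg_series_cvg_0; apply: nondecreasing_is_cvgn.
    by apply: nondecreasing_series => n _ _; exact: sqr_ge0.
  exists (2^-1 * \int[torus_measure R]_y (G y ^+ 2)) => _ [n _ <-].
  rewrite /series/= big_mkord; apply: bessel => //; first exact: torus_integral_odd_sin.
apply/cvgr0Pnorm_lt => eps eps0.
near=> n.
have : `|u n ^+ 2| < eps ^+ 2.
  by near: n; exact: ((cvgr0Pnorm_lt _).1 u2 (eps ^+ 2) (exprn_gt0 _ eps0)).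
by rewrite normrX ltr_pXn2r// nnegrE ?ltW.
Unshelve. all: by end_near. Qed.

(** * A weak-type Hausdorff-Young inequality *)

Lemma measurable_superlevel (R : realType) (F : R -> R) (l : R) :
  measurable_fun setT F -> measurable [set x | l <= `|F x|].
Proof.
move=> mF; have mnF : measurable_fun setT (fun x => `|F x|).
  exact: measurableT_comp.
have -> : [set x | l <= `|F x|] = setT `&` (fun x => `|F x|) @^-1` `[l, +oo[.
  by rewrite setTI; apply/seteqP; split=> x /=; rewrite in_itv/= andbT.
exact: mnF.
Qed.

(** Where |F| >= 2 a, the excess of |F| over a is at least a, and it is the limit of
the excess of |S_n| over a, which is dominated by |Q_n|. Fatou's lemma therefore
passes the L^2 bound to the limit although Q_n itself need not converge. *)
Lemma chebyshev_fatou (R : realType) (F : R -> R) (S Q : nat -> R -> R) (a kappa : R) :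
  0 < a -> measurable_fun setT F -> (forall n, measurable_fun setT (S n)) ->
  (forall n, torus_bounded (Q n)) ->
  (forall x, 0 <= x < 1 -> (fun n => S n x) @ \oo --> F x) ->
  (forall n x, `|S n x| <= a + `|Q n x|) ->
  (forall n, \int[torus_measure R]_x (Q n x ^+ 2) <= kappa) ->
  (torus_measure R [set x | (2 * a <= `|F x|)%R] <= (kappa / a ^+ 2)%:E)%E.
Proof.
move=> a0 mF mS Qb SF SQ Qk.
pose f (y : R) := (Num.max (`|y| - a) 0) ^+ 2.
have cf : continuous f.
  have cm : continuous (fun y : R => Num.max (`|y| - a) 0).
    move=> y; apply: (@continuous_max R R (fun y => `|y| - a) (cst 0) y).
      by apply: cvgB; [exact: norm_continuous|exact: cvg_cst].
    exact: cst_continuous.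
  by move=> y; rewrite /f; under eq_fun do rewrite expr2; apply: cvgM; exact: cm.
have mf : measurable_fun setT f by exact: continuous_measurable_fun.
have mfS n : measurable_fun setT (fun x => f (S n x)).
  exact: (measurableT_comp mf (mS n)).
have f_ge0 y : 0 <= f y by exact: sqr_ge0.
pose D : set R := `[0, 1[.
have mD : measurable D by exact: measurable_itv.
have mfF : measurable_fun D (EFin \o (f \o F)).
  by apply: measurable_funTS; apply/measurable_EFinP; exact: measurableT_comp.
have intf : (\int[torus_measure R]_(x in D) (f (F x))%:E <= kappa%:E)%E.
  have <- : (\int[torus_measure R]_(x in D) limn_einf (fun n => (f (S n x))%:E) =
     \int[torus_measure R]_(x in D) (f (F x))%:E)%E.
    apply: eq_integral => x; rewrite inE /D /= in_itv /= => xI.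
    apply: (fst (cvg_limn_einf_sup _)); apply: cvg_EFin; first exact: nearW.
    apply: (@cvg_comp _ _ _ (fun n => S n x) f); [exact: (SF x xI)|exact: cf].
  apply: le_trans (fatou _ _ _ _) _ => //.
    move=> n; apply: measurable_funTS; apply/measurable_EFinP.
    exact: mfS.
    by move=> n x _; rewrite lee_fin.
  rewrite limn_einf_lim; apply: lime_le; first exact: is_cvg_einfs.
  apply: nearW => n.
  apply: (@le_trans _ _ (\int[torus_measure R]_(x in D) (f (S n x))%:E)%E).
    by apply: ereal_inf_lbound; exists n => /=.
  apply: (@le_trans _ _ (\int[torus_measure R]_x (Q n x ^+ 2)%:E)%E).
    have mQ2 : measurable_fun setT (fun x => (Q n x ^+ 2)%:E).
      by apply/measurable_EFinP; apply: measurable_funX; exact: (Qb n).1.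
    apply: (@le_trans _ _ (\int[torus_measure R]_(x in D) (Q n x ^+ 2)%:E)%E).
      apply: ge0_le_integral => //.
      - by move=> x _; rewrite lee_fin.
      - by apply: measurable_funTS; apply/measurable_EFinP; exact: mfS.
      - exact: measurable_funTS.
      - move=> x _; rewrite lee_fin /f -[leRHS]real_normK ?num_real//.
        rewrite ler_pXn2r ?nnegrE ?le_max ?lexx ?orbT// ge_max normr_ge0 andbT.
        by rewrite lerBlDl.
    by apply: ge0_subset_integral => // x _; rewrite lee_fin sqr_ge0.
  have Q2b : torus_bounded (fun x => Q n x ^+ 2).
    by under eq_fun do rewrite expr2; exact: torus_boundedM.
  have := Qk n; rewrite -lee_fin /Rintegral fineK//.
  exact: integrable_fin_num (torus_bounded_int Q2b).
set E := [set x | _]; have mE : measurable E by exact: measurable_superlevel.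
rewrite torus_measure_restr EFinM lee_pdivlMr ?exprn_gt0//.
apply: le_trans intf; rewrite muleC -integral_cst//; last exact: measurableI.
apply: (@le_trans _ _ (\int[torus_measure R]_(x in E `&` D) (f (F x))%:E)%E); last first.
  apply: ge0_subset_integral => //; first exact: measurableI.
  by move=> x _; rewrite lee_fin.
have mED : measurable (E `&` D) by exact: measurableI.
apply: ge0_le_integral => //.
- by move=> x _; rewrite lee_fin sqr_ge0.
- exact: measurable_funS mfF.
- move=> x [Ex _]; rewrite lee_fin /f ler_pXn2r ?nnegrE ?le_max ?lexx ?orbT ?(ltW a0)//.
  by apply/orP; left; move: Ex; rewrite /E/=; lra.
Qed.

(** Marcinkiewicz-style splitting between l^1 -> L^oo and l^2 -> L^2. The height tau
is chosen so that the terms with rho_i > tau sum to at most lam / 2 everywhere;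
the other terms form the Q_n of [chebyshev_fatou]. *)
Lemma hausdorff_young_weak (R : realType) (s lam A : R) (c : nat -> R -> R)
    (rho : nat -> R) (F : R -> R) :
  2 <= s -> 0 < lam -> 0 < A -> measurable_fun setT F ->
  (forall i, continuous (c i)) -> (forall i, 0 <= rho i) ->
  (forall i x, `|c i x| <= 2 * rho i) ->
  (forall i j, \int[torus_measure R]_x (c i x * c j x)
               = (i == j)%:R * (2 * rho i ^+ 2)) ->
  (forall x, 0 <= x < 1 -> (fun n => \sum_(i < n) c i x) @ \oo --> F x) ->
  (forall n, \sum_(i < n) rho i `^ (s / (s - 1)) <= A `^ (s / (s - 1))) ->
  (torus_measure R [set x | (lam <= `|F x|)%R]
     <= (2 * 4 `^ (s - 1) * (A / lam) `^ s)%:E)%E.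
Proof.
move=> s2 l0 A0 mF cc rho0 crho co cF rhoA.
set t := s / (s - 1) in rhoA *.
have s1 : 0 < s - 1 by lra.
have s1t : (s - 1) * (1 - t) = -1 by rewrite /t; field; rewrite gt_eqF.
have t1 : 1 <= t by rewrite /t ler_pdivlMr// mul1r; lra.
have t2 : t <= 2 by rewrite /t ler_pdivrMr//; lra.
(* tau solves 4 tau^(1 - t) A^t = lam, since (s - 1) (1 - t) = -1. *)
pose b := 4 * A `^ t / lam.
have b0 : 0 < b by rewrite divr_gt0// mulr_gt0// powR_gt0.
pose tau := b `^ (s - 1).
have tau0 : 0 < tau by exact: powR_gt0.
have tauE : tau `^ (1 - t) * A `^ t = lam / 4.
  rewrite /tau -powRrM s1t powR_inv1 ?ltW// /b invfM invfM invrK.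
  have : A `^ t != 0 by rewrite gt_eqF// powR_gt0.
  by move=> At0; field.
have -> : 2 * 4 `^ (s - 1) * (A / lam) `^ s = (tau * lam / 2) / (lam / 2) ^+ 2.
  have -> : tau = 4 `^ (s - 1) * (A `^ s * lam `^ (1 - s)).
    rewrite /tau /b -mulrA powRM ?powRM ?powR_ge0 ?mulr_ge0 ?invr_ge0 ?powR_ge0 ?(ltW l0)//.
    rewrite -powRrM -[lam^-1]powR_inv1 ?(ltW l0)// -powRrM mulN1r opprB.
    by rewrite /t divfK// gt_eqF.
  rewrite powRM ?invr_ge0 ?(ltW A0) ?(ltW l0)//.
  rewrite -[lam^-1]powR_inv1 ?(ltW l0)// -powRrM mulN1r.
  have -> : lam `^ (1 - s) = lam * lam `^ (- s).
    by rewrite powRD; [rewrite powRr1 ?(ltW l0)|rewrite (gt_eqF l0) implybT].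
  by field; rewrite gt_eqF.
pose S n x := \sum_(i < n) c i x.
pose Q n x := \sum_(i < n | rho i <= tau) c i x.
have cb i : torus_bounded (c i) by exact: torus_bounded_continuous.
have -> : [set x | lam <= `|F x|] = [set x | 2 * (lam / 2) <= `|F x|].
  by rewrite (_ : 2 * (lam / 2) = lam)//; field.
apply: (@chebyshev_fatou _ F S Q) => //.
- by rewrite divr_gt0.
- by move=> n; apply: (torus_bounded_sum _ _ _).1.
- by move=> n; apply: torus_bounded_sum.
- move=> n x; rewrite /S (bigID (fun i : 'I_n => rho i <= tau))/= addrC.
  apply: (le_trans (ler_normD _ _)); rewrite lerD2r.
  apply: (le_trans (ler_norm_sum _ _ _)).
  apply: (@le_trans _ _ (\sum_(i < n) 2 * (tau `^ (1 - t) * rho i `^ t))).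
    rewrite big_mkcond; apply: ler_sum => i _; case: ifP => [|_]; last first.
      by rewrite !mulr_ge0 ?powR_ge0.
    (* rho = rho^(1 - t) rho^t with 1 - t <= 0, so rho > tau bounds the first factor. *)
    rewrite -ltNge => trho; apply: (le_trans (crho i x)); rewrite ler_pM2l//.
    have r0 : 0 < rho i := lt_trans tau0 trho.
    rewrite -[leLHS]powRr1 ?(ltW r0)// -{1}[1](subrK t) powRD; last first.
      by rewrite (gt_eqF r0) implybT.
    apply: ler_wpM2r; first exact: powR_ge0.
    rewrite -[1 - t]opprK powRN [leRHS]powRN lef_pV2 ?posrE ?powR_gt0//.
    by apply: ge0_ler_powR; rewrite ?nnegrE ?(ltW tau0) ?(ltW r0) ?(ltW trho)//; lra.
  rewrite -!mulr_sumr; have := ler_wpM2l (powR_ge0 tau (1 - t)) (rhoA n).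
  rewrite tauE; set z := _ * _; lra.
- move=> n; rewrite (@torus_orthogonal_sum _ n (fun i => rho i <= tau) c
    (fun i => 2 * rho i ^+ 2))//.
  apply: (@le_trans _ _ (\sum_(i < n) 2 * (tau `^ (2 - t) * rho i `^ t))).
    rewrite [leLHS]big_mkcond; apply: ler_sum => i _; case: ifP => [|_]; last first.
      by rewrite !mulr_ge0 ?powR_ge0.
    move=> trho; rewrite ler_pM2l//.
    have [->|r0] := eqVneq (rho i) 0.
      by rewrite expr0n/= mulr_ge0 ?powR_ge0.
    rewrite -powR_mulrn// -{1}[2%:R](subrK t) powRD; last by rewrite r0 implybT.
    apply: ler_wpM2r; first exact: powR_ge0.
    by apply: ge0_ler_powR; rewrite ?nnegrE ?(ltW tau0)//; lra.
  rewrite -!mulr_sumr; have := ler_wpM2l (powR_ge0 tau (2 - t)) (rhoA n).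
  have -> : tau `^ (2 - t) = tau * tau `^ (1 - t).
    rewrite -{2}[tau]powRr1 ?(ltW tau0)// -powRD; last by rewrite (gt_eqF tau0) implybT.
    by congr powR; ring.
  rewrite -[X in _ <= X -> _]mulrA tauE; set z := _ * _; lra.
Qed.

Lemma sq_cos_sin_le (R : realType) (a b u : R) :
  `|a * cos u + b * sin u| <= Num.sqrt (a ^+ 2 + b ^+ 2).
Proof.
rewrite -sqrtr_sqr ler_wsqrtr//.
have : 0 <= (a * sin u - b * cos u) ^+ 2 by exact: sqr_ge0.
have := cos2Dsin2 u; nra.
Qed.

Lemma torus_integral_trig_orthogonal (R : realType) (a b : nat -> R) (i j : nat) :
  let c i (x : R) := 2 * (a i * cos (2 * pi * i.+1%:R * x)
                          + b i * sin (2 * pi * i.+1%:R * x)) in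
  \int[torus_measure R]_x (c i x * c j x)
  = (i == j)%:R * (2 * (a i ^+ 2 + b i ^+ 2)).
Proof.
move=> c; pose C i d (x : R) : R := cos (2 * pi * i.+1%:R * x + d).
(* A sine is a cosine with phase h. *)
pose h : R := - (pi / 2).
have cE k x : c k x = 2 * (a k * C k 0 x + b k * C k h x).
  by rewrite /c /C addr0 /h cosBpihalf.
have Cb k d : torus_bounded (C k d).
  by apply: torus_bounded_continuous; exact: continuous_cos_affine.
have CC d d' : \int[torus_measure R]_x (C i d x * C j d' x)
    = (i == j)%:R * (2^-1 * cos (d - d')).
  by rewrite torus_integral_cosMcos.
have CCb d d' k : torus_bounded (fun x => k * (C i d x * C j d' x)).
  by apply: torus_boundedM; [exact: torus_bounded_cst|exact: torus_boundedM].
have -> : \int[torus_measure R]_x (c i x * c j x) = \int[torus_measure R]_x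
   ((4 * a i * a j * (C i 0 x * C j 0 x) + 4 * a i * b j * (C i 0 x * C j h x))
   + (4 * b i * a j * (C i h x * C j 0 x) + 4 * b i * b j * (C i h x * C j h x))).
  by apply: eq_Rintegral => x _; rewrite !cE; ring.
rewrite torus_integralD; [|exact: torus_boundedD|exact: torus_boundedD].
rewrite !torus_integralD// !torus_integralZ; try exact: torus_boundedM.
rewrite !CC subr0 sub0r subrr subr0 cos0 cosN /h cosN cos_pihalf.
have [->|_] := eqVneq i j; last by rewrite !mul0r !mulr0 !addr0.
by rewrite !mul1r !mulr0; field.
Qed.

(** Integration by parts; the boundary terms cancel by periodicity of Phi and of
the trigonometric functions. *)
Lemma torus_integral_primitive_trig (R : realType) (phi Phi : R -> R) (n : nat) :
  continuous phi -> continuous Phi ->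
  (forall x : R, 0 <= x <= 1 -> is_derive x 1 Phi (phi x)) -> Phi 0 = Phi 1 ->
  let th : R := 2 * pi * n.+1%:R in
  \int[torus_measure R]_x (Phi x * cos (th * x))
    = - (th^-1 * \int[torus_measure R]_x (phi x * sin (th * x))) /\
  \int[torus_measure R]_x (Phi x * sin (th * x))
    = th^-1 * \int[torus_measure R]_x (phi x * cos (th * x)).
Proof.
move=> cphi cPhi dPhi Phi01 th.
have th0 : th != 0 by rewrite gt_eqF// !mulr_gt0 ?pi_gt0 ?ltr0n.
have ccos := @continuous_cosM R th; have csin := @continuous_sinM R th.
have cM (f g : R -> R) : continuous f -> continuous g -> continuous (fun x => f x * g x).
  by move=> cf cg x; apply: cvgM; [exact: cf|exact: cg].
have b (f g : R -> R) :
    continuous f -> continuous g -> torus_bounded (fun x => f x * g x).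
  by move=> cf cg; apply: torus_bounded_continuous; exact: cM.
have costh : cos th = 1 by have := @cosD2pin R n.+1 0; rewrite addr0 cos0.
have sinth : sin th = 0 by have := @sinD2pin R n.+1 0; rewrite addr0 sin0.
split.
- have dM (x : R) : 0 <= x <= 1 -> is_derive x 1 (fun x => Phi x * sin (th * x))
      (phi x * sin (th * x) + th * (Phi x * cos (th * x))).
    move=> xI; apply: (is_derive_eq (is_deriveM (dPhi x xI) (is_derive_sinM th x))).
    by rewrite /GRing.scale/=; ring.
  have cth : continuous (fun x => th * (Phi x * cos (th * x))).
    by move=> x; apply: cvgM; [exact: cvg_cst|exact: cM].
  have := torus_FTC _ dM; rewrite mulr1 mulr0 sinth sin0 !mulr0 subrr.
  rewrite torus_integralD; [|exact: b|exact: torus_bounded_continuous].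
  rewrite torus_integralZ; last exact: b.
  set X := Rintegral _ _ _; set Y := Rintegral _ _ _ => h.
  have XY : X + th * Y = 0 by apply: h => x; apply: cvgD; [exact: cM|exact: cth].
  have -> : X = - (th * Y) by lra.
  by rewrite mulrN opprK mulrA mulVf// mul1r.
- have dM (x : R) : 0 <= x <= 1 -> is_derive x 1 (fun x => Phi x * cos (th * x))
      (phi x * cos (th * x) + - th * (Phi x * sin (th * x))).
    move=> xI; apply: (is_derive_eq (is_deriveM (dPhi x xI) (is_derive_cosM th x))).
    by rewrite /GRing.scale/=; ring.
  have cth : continuous (fun x => - th * (Phi x * sin (th * x))).
    by move=> x; apply: cvgM; [exact: cvg_cst|exact: cM].
  have := torus_FTC _ dM; rewrite mulr1 mulr0 costh cos0 !mulr1 Phi01 subrr.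
  rewrite torus_integralD; [|exact: b|exact: torus_bounded_continuous].
  rewrite torus_integralZ; last exact: b.
  set X := Rintegral _ _ _; set Y := Rintegral _ _ _ => h.
  have XY : X + - th * Y = 0 by apply: h => x; apply: cvgD; [exact: cM|exact: cth].
  have -> : X = th * Y by lra.
  by rewrite mulrA mulVf// mul1r.
Qed.

(** The summands are the moduli of the Fourier coefficients of Phi, expressed
through those of its derivative phi. Since phi is real, the frequency -k
contributes as much as k, so only positive frequencies appear. *)
Lemma primitive_superlevel (R : realType) (phi Phi : R -> R) (s lam A : R) :
  2 <= s -> 0 < lam -> 0 < A -> continuous phi -> continuous Phi ->
  (forall x : R, 0 <= x <= 1 -> is_derive x 1 Phi (phi x)) -> Phi 0 = Phi 1 ->
  \int[torus_measure R]_y Phi y = 0 ->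
  (forall n, \sum_(i < n)
     (Num.sqrt ((\int[torus_measure R]_x (phi x * cos (2 * pi * i.+1%:R * x))) ^+ 2
              + (\int[torus_measure R]_x (phi x * sin (2 * pi * i.+1%:R * x))) ^+ 2)
      / (2 * pi * i.+1%:R)) `^ (s / (s - 1)) <= A `^ (s / (s - 1))) ->
  (torus_measure R [set x | (lam <= `|Phi x|)%R]
     <= (2 * 4 `^ (s - 1) * (A / lam) `^ s)%:E)%E.
Proof.
move=> s2 l0 A0 cphi cPhi dPhi Phi01 Phi0 rhoA.
pose th (i : nat) : R := 2 * pi * i.+1%:R.
have th0 i : 0 < th i by rewrite /th !mulr_gt0 ?pi_gt0 ?ltr0n.
pose a i := \int[torus_measure R]_x (Phi x * cos (th i * x)).
pose b i := \int[torus_measure R]_x (Phi x * sin (th i * x)).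
pose rho i := Num.sqrt (a i ^+ 2 + b i ^+ 2).
have ab0 i : 0 <= a i ^+ 2 + b i ^+ 2 by rewrite addr_ge0// sqr_ge0.
pose c i x := 2 * (a i * cos (th i * x) + b i * sin (th i * x)).
have ccos i := @continuous_cosM R (th i); have csin i := @continuous_sinM R (th i).
apply: (@hausdorff_young_weak _ _ _ _ c rho) => //.
- exact: continuous_measurable_fun.
- move=> i x; apply: cvgM; first exact: cvg_cst.
  apply: cvgD; apply: cvgM; try exact: cvg_cst.
    exact: continuous_cosM.
  exact: continuous_sinM.
- by move=> i; exact: sqrtr_ge0.
- by move=> i x; rewrite normrM ger0_norm// ler_pM2l// sq_cos_sin_le.
- by move=> i j; rewrite torus_integral_trig_orthogonal sqr_sqrtr.
- move=> x /andP[x0 /ltW x1].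
  have := @fourier_pointwise R phi Phi x cphi cPhi dPhi Phi01 Phi0.
  rewrite x0 x1 => /(_ isT).
  suff -> : (fun n => \sum_(i < n) 2 *
    \int[torus_measure R]_y (Phi y * cos (2 * pi * i.+1%:R * (x - y))))
    = (fun n => \sum_(i < n) c i x) by [].
  apply/funext => n; apply: eq_bigr => i _; apply/esym; rewrite /c; congr (2 * _).
  have Pb (f : R -> R) : continuous f -> torus_bounded (fun y => Phi y * f y).
    move=> cf; apply: torus_bounded_continuous => y; apply: cvgM; [exact: cPhi|exact: cf].
  rewrite mulrC [b i * _]mulrC -!torus_integralZ; [|exact: Pb|exact: Pb].
  rewrite -torus_integralD; last 2 first.
  + by apply: torus_boundedM; [exact: torus_bounded_cst|exact: Pb].
  + by apply: torus_boundedM; [exact: torus_bounded_cst|exact: Pb].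
  apply: eq_Rintegral => y _; rewrite -/(th i) mulrBr cosB; ring.
- move=> n; apply: le_trans (rhoA n); rewrite le_eqVlt; apply/orP; left; apply/eqP.
  apply: eq_bigr => i _; congr powR; rewrite /rho /a /b.
  have [-> ->] := torus_integral_primitive_trig i cphi cPhi dPhi Phi01.
  rewrite -/(th i) sqrrN !exprMn -mulrDr addrC sqrtrM ?sqr_ge0// sqrtr_sqr.
  by rewrite ger0_norm ?invr_ge0 ?(ltW (th0 i))// mulrC.
Qed.

(** * Fourier coefficients of the splitting *)

Lemma torus_aeS (R : realType) (P Q : R -> Prop) :
  (forall x, P x -> Q x) -> {ae torus_measure R, forall x, P x} ->
  {ae torus_measure R, forall x, Q x}.
Proof.
by move=> PQ [N [mN N0 PN]]; exists N; split => // x /= nQ; apply: PN => /PQ.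
Qed.

Lemma sum_le_esum (R : realType) (f : int -> R) (S : set int) (n : nat) :
  (forall k, 0 <= f k) -> (forall i : nat, S i.+1) ->
  ((\sum_(i < n) f i.+1)%:E <= \esum_(k in S) (f k)%:E)%E.
Proof.
move=> f0 Sn; pose e (i : nat) : int := i.+1.
have einj : set_inj `I_n e by move=> i j _ _ [].
have fin : finite_set (e @` `I_n) by exact/finite_image/finite_II.
apply: esum_ge; exists (e @` `I_n); first by split=> // ? [i _ <-]; exact: Sn.
rewrite -esum_fset//; last by move=> k _; rewrite lee_fin.
rewrite (esum_image _ e (fun k => (f k)%:E) einj) esum_fset; last 2 first.
- exact: finite_II.
- by move=> k _; rewrite lee_fin.
by rewrite -fsbig_ord sumEFin.
Qed.

Lemma sum_le_poweR_esum (R : realType) (f : int -> R) (S : set int) (t H : R) (n : nat) :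
  0 < t -> (forall k, 0 <= f k) -> (forall i : nat, S i.+1) ->
  poweR (\esum_(k in S) (f k)%:E) t^-1 = H%:E ->
  \sum_(i < n) f i.+1 <= H `^ t.
Proof.
move=> t0 f0 Sn; have := sum_le_esum n f0 Sn.
have e0 : (0 <= \esum_(k in S) (f k)%:E)%E by apply: esum_ge0 => k _; rewrite lee_fin.
case: (\esum_(k in S) (f k)%:E)%E e0 => [e e0|_ _|//]; last first.
  by rewrite poweRyr// invr_eq0 gt_eqF.
rewrite !lee_fin in e0 * => le_e; rewrite poweR_EFin => -[<-].
by rewrite -powRrM mulVf ?gt_eqF// powRr1.
Qed.

Lemma torus_integrableM (R : realType) (u w : R -> R) :
  (torus_measure R).-integrable setT (EFin \o u) -> measurable_fun setT w ->
  (forall x, `|w x| <= 1) ->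
  (torus_measure R).-integrable setT (EFin \o (fun x => u x * w x)).
Proof.
move=> iu mw w1; have := @integrableMl _ _ _ (torus_measure R) _ measurableT _ w iu mw.
apply; exists 1; split; first exact: num_real.
by move=> K K1 x _ /=; rewrite (le_trans (w1 x))// ltW.
Qed.

(** Equality almost everywhere is enough for the coefficients to add up. The real and
the imaginary part are kept apart to fit the real trigonometric system. *)
Lemma fourier_coef_split (R : realType) (phi : R -> R) (h g : R -> R[i]) (k : int) :
  continuous phi -> torus_cintegrable h -> torus_cintegrable g ->
  {ae torus_measure R, forall x, Complex (phi x) 0 = h x + g x} ->
  fourier_coef h k + fourier_coef g k
  = Complex (\int[torus_measure R]_x (phi x * cos (2 * pi * k%:~R * x)))
            (- \int[torus_measure R]_x (phi x * sin (2 * pi * k%:~R * x))).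
Proof.
move=> cphi [ihr ihi] [igr igi] hg.
pose th : R := 2 * pi * k%:~R.
have mcos := continuous_measurable_fun (@continuous_cosM R th).
have msin := continuous_measurable_fun (@continuous_sinM R th).
have cos1 x : `|cos (th * x)| <= 1 by exact: cos_max.
have sin1 x : `|sin (th * x)| <= 1 by exact: sin_max.
have iC u (iu : (torus_measure R).-integrable setT (EFin \o u)) :=
  torus_integrableM iu mcos cos1.
have iS u (iu : (torus_measure R).-integrable setT (EFin \o u)) :=
  torus_integrableM iu msin sin1.
have iphi := torus_continuous_integrable cphi.
have coefE (f : R -> R[i]) :
    (torus_measure R).-integrable setT (EFin \o (fun x => complex.Re (f x))) ->
    (torus_measure R).-integrable setT (EFin \o (fun x => complex.Im (f x))) ->
  fourier_coef f k = Complex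
    (\int[torus_measure R]_x (complex.Re (f x) * cos (th * x))
     + \int[torus_measure R]_x (complex.Im (f x) * sin (th * x)))
    (\int[torus_measure R]_x (complex.Im (f x) * cos (th * x))
     - \int[torus_measure R]_x (complex.Re (f x) * sin (th * x))).
  move=> ir ii; rewrite -RintegralD ?iC ?iS// -RintegralB ?iC ?iS//.
  congr Complex; apply: eq_Rintegral => x _; rewrite /fourier_mode -/th.
    by case: (f x) => u v /=; ring.
  by case: (f x) => u v /=; ring.
have aeD (u v w : R -> R) :
    (torus_measure R).-integrable setT (EFin \o u) ->
    (torus_measure R).-integrable setT (EFin \o v) ->
    (torus_measure R).-integrable setT (EFin \o w) ->
    {ae torus_measure R, forall x, w x = u x + v x} ->
    \int[torus_measure R]_x u x + \int[torus_measure R]_x v x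
    = \int[torus_measure R]_x w x.
  move=> iu iv iw uvw; rewrite -RintegralD// /Rintegral; congr fine.
  apply: ae_eq_integral => //.
  - exact: measurable_int (integrableD measurableT iu iv).
  - exact: measurable_int iw.
  - by apply: torus_aeS uvw => x -> _.
rewrite !coefE//.
have E1 : \int[torus_measure R]_x (complex.Re (h x) * cos (th * x))
     + \int[torus_measure R]_x (complex.Re (g x) * cos (th * x))
   = \int[torus_measure R]_x (phi x * cos (th * x)).
  apply: aeD; try exact: iC; apply: torus_aeS hg => x.
  by case: (h x) (g x) => [u v] [u' v'] [-> _] /=; rewrite mulrDl.
have E2 : \int[torus_measure R]_x (complex.Re (h x) * sin (th * x))
     + \int[torus_measure R]_x (complex.Re (g x) * sin (th * x))
   = \int[torus_measure R]_x (phi x * sin (th * x)).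
  apply: aeD; try exact: iS; apply: torus_aeS hg => x.
  by case: (h x) (g x) => [u v] [u' v'] [-> _] /=; rewrite mulrDl.
have i0 : (torus_measure R).-integrable setT (EFin \o (fun=> 0 : R)).
  by apply: torus_continuous_integrable; exact: cst_continuous.
have I0 : \int[torus_measure R]_x (0 : R) = 0 by rewrite Rintegral_cst// mul0r.
have E3 : \int[torus_measure R]_x (complex.Im (h x) * cos (th * x))
     + \int[torus_measure R]_x (complex.Im (g x) * cos (th * x)) = 0.
  rewrite -[RHS]I0; apply: aeD => //; try exact: iC; apply: torus_aeS hg => x.
  by case: (h x) (g x) => [u v] [u' v'] [_ e] /=; rewrite -mulrDl -e mul0r.
have E4 : \int[torus_measure R]_x (complex.Im (h x) * sin (th * x))
     + \int[torus_measure R]_x (complex.Im (g x) * sin (th * x)) = 0.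
  rewrite -[RHS]I0; apply: aeD => //; try exact: iS; apply: torus_aeS hg => x.
  by case: (h x) (g x) => [u v] [u' v'] [_ e] /=; rewrite -mulrDl -e mul0r.
have addC (a b c d : R) : Complex a b + Complex c d = Complex (a + c) (b + d) by [].
rewrite -/th -E1 -E2 addC; congr Complex; first by rewrite addrACA E4 addr0.
by rewrite addrACA E3 add0r opprD.
Qed.

Lemma conj_exp_fin (R : realType) (s : R) : 1 < s -> conj_exp s%:E = s / (s - 1).
Proof.
move=> s1; have s0 : s != 0 by rewrite gt_eqF// (lt_trans ltr01).
have s10 : s - 1 != 0 by rewrite gt_eqF// subr_gt0.
by rewrite /conj_exp /hoelder_conjugate /= eqe (negbTE s0) -EFinB inver (negbTE s10).
Qed.

Lemma half_le_max (R : realType) (x y w : R) :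
  w <= x + y -> 2^-1 * w <= Num.max x y.
Proof. by move=> wxy; case: (leP x y) => xy; lra. Qed.

(** For a frequency k below M the coefficient of h vanishes, and for k >= M division
by k gains M^-1. Thanks to the factor 1 / (2 pi) <= 1/2, each term is then at
most the larger of the corresponding terms of M^-1 h and of the seminorm of g.
The t-th power of the larger is at most the sum of the t-th powers, and the
constant 2 on the right absorbs that there are two sums. *)
Lemma split_coef_bound (R : realType) (s M H G : R) (phi : R -> R) (h g : R -> R[i]) n :
  2 <= s -> split_function s M phi h g ->
  seq_norm (conj_exp s%:E) (fourier_coef h) = H%:E ->
  fourier_lebesgue_norm (conj_exp s%:E) g = G%:E ->
  \sum_(i < n)
     (Num.sqrt ((\int[torus_measure R]_x (phi x * cos (2 * pi * i.+1%:R * x))) ^+ 2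
              + (\int[torus_measure R]_x (phi x * sin (2 * pi * i.+1%:R * x))) ^+ 2)
      / (2 * pi * i.+1%:R)) `^ (s / (s - 1))
  <= (2 * (M^-1 * H + G)) `^ (s / (s - 1)).
Proof.
move=> s2 [M0 _ cphi _ _ _ _ _ ih ig hg hlow _ _].
rewrite conj_exp_fin; last lra.
set t := s / (s - 1).
have s1 : 0 < s - 1 by lra.
have t1 : 1 <= t by rewrite /t ler_pdivlMr// mul1r; lra.
have t0 : 0 < t by lra.
move=> HE GE.
have H0 : 0 <= H by rewrite -lee_fin -HE poweR_ge0.
have G0 : 0 <= G by rewrite -lee_fin -GE poweR_ge0.
pose nh (k : int) := ComplexField.Normc.normc (fourier_coef h k).
pose ng (k : int) := ComplexField.Normc.normc (fourier_coef g k).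
have normc_ge0 (z : R[i]) : 0 <= ComplexField.Normc.normc z.
  by case: z => a b /=; exact: sqrtr_ge0.
have HS : \sum_(i < n) nh i.+1 `^ t <= H `^ t.
  by apply: (sum_le_poweR_esum n t0 _ _ HE) => // k; exact: powR_ge0.
have GS : \sum_(i < n) (ng i.+1 `^ t / `|(i.+1 : int)%:~R| `^ t) <= G `^ t.
  apply: (@sum_le_poweR_esum R (fun k => ng k `^ t / `|k%:~R| `^ t) _ t G n t0 _ _ GE) => //.
  by move=> k; rewrite divr_ge0// powR_ge0.
set D := M^-1 * H + G.
have D0 : 0 <= D by rewrite addr_ge0// mulr_ge0// invr_ge0 ltW.
apply: (@le_trans _ _ (\sum_(i < n) (M^-1 `^ t * nh i.+1 `^ t
    + ng i.+1 `^ t / `|(i.+1 : int)%:~R| `^ t))).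
  apply: ler_sum => i _; set k : R := i.+1%:R.
  have k0 : 0 < k by rewrite ltr0n.
  have kE : (i.+1 : int)%:~R = k :> R by rewrite /k pmulrn.
  have := fourier_coef_split i.+1 cphi ih ig hg; rewrite kE => sE.
  have zle : Num.sqrt ((\int[torus_measure R]_x (phi x * cos (2 * pi * k * x))) ^+ 2
              + (\int[torus_measure R]_x (phi x * sin (2 * pi * k * x))) ^+ 2)
      <= nh i.+1 + ng i.+1.
    rewrite -[X in _ + X]sqrrN.
    have nD (x y : R[i]) : ComplexField.Normc.normc (x + y)
        <= ComplexField.Normc.normc x + ComplexField.Normc.normc y.
      exact: le_normcD.
    by apply: le_trans (nD _ _); rewrite sE.
  rewrite (gtr0_norm k0); set z := Num.sqrt _ in zle *.
  have z0 : 0 <= z by exact: sqrtr_ge0.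
  have nh0 : 0 <= nh i.+1 by exact: normc_ge0.
  have ng0 : 0 <= ng i.+1 by exact: normc_ge0.
  have nhle : nh i.+1 / k <= M^-1 * nh i.+1.
    have [kM|Mk] := ltP k M.
      rewrite /nh hlow ?kE ?gtr0_norm// /ComplexField.Normc.normc/=.
      by rewrite expr0n/= addr0 sqrtr0 mul0r mulr0.
    by rewrite mulrC ler_wpM2r// lef_pV2 ?posrE.
  rewrite -powRM// ?invr_ge0 ?(ltW M0)//.
  have -> : ng i.+1 `^ t / k `^ t = (ng i.+1 / k) `^ t.
    rewrite powRM ?invr_ge0 ?(ltW k0)//; congr (_ * _).
    by rewrite -[k^-1]powR_inv1 ?(ltW k0)// -powRrM mulN1r powRN.
  have b0 : 0 <= ng i.+1 / k by rewrite divr_ge0// ltW.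
  have a0 : 0 <= M^-1 * nh i.+1 by rewrite mulr_ge0// invr_ge0 ltW.
  set a := M^-1 * nh i.+1 in nhle a0 *; set b := ng i.+1 / k in b0 *.
  have zab : z / (2 * pi * k) <= Num.max a b.
    have pi2 := pi_ge2 R.
    have : z / (2 * pi * k) <= 2^-1 * (z / k).
      rewrite !invfM [_ * k^-1]mulrC mulrA [2^-1 * _]mulrC -mulrA.
      rewrite [leLHS]mulrA; apply: ler_wpM2l; first by rewrite divr_ge0// ltW.
      rewrite ler_piMr ?invr_ge0// invf_le1//; lra.
    move/le_trans; apply.
    apply: half_le_max.
    by apply: (le_trans (ler_wpM2r _ zle)); rewrite ?invr_ge0 ?(ltW k0)// mulrDl lerD2r.
  apply: (@le_trans _ _ (Num.max a b `^ t)).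
    apply: ge0_ler_powR; rewrite ?nnegrE ?(ltW t0)// ?divr_ge0// ?le_max ?a0//.
    by rewrite !mulr_ge0 ?pi_ge0 ?(ltW k0).
  by case: (leP a b) => _; rewrite ?lerDr ?lerDl powR_ge0.
rewrite big_split/= -mulr_sumr.
apply: (@le_trans _ _ (D `^ t + D `^ t)).
  apply: lerD.
    apply: (le_trans (ler_wpM2l (powR_ge0 _ _) HS)).
    rewrite -powRM// ?invr_ge0 ?(ltW M0)//.
    by apply: ge0_ler_powR; rewrite ?nnegrE ?(ltW t0)// ?mulr_ge0 ?invr_ge0 ?(ltW M0)// lerDl.
  apply: (le_trans GS).
  by apply: ge0_ler_powR; rewrite ?nnegrE ?(ltW t0)// lerDr mulr_ge0// invr_ge0 ltW.
rewrite powRM// -mulr2n -[_ *+ 2]mulr_natl; apply: ler_wpM2r; first exact: powR_ge0.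
by rewrite -{1}[2%:R]powRr1//; apply: ler_powR => //; lra.
Qed.

(** * Norms on the torus *)

Lemma torus_norm1 (R : realType) (phi : R -> R) : continuous phi ->
  torus_norm 1 phi = (\int[torus_measure R]_x `|phi x|)%:E.
Proof.
move=> cphi; rewrite /torus_norm Lnorm1 /Rintegral fineK//.
have cn := continuous_normr cphi.
exact: integrable_fin_num (torus_continuous_integrable cn).
Qed.

Lemma torus_norm_ae_le (R : realType) (phi : R -> R) :
  {ae torus_measure R, forall x, (`|phi x|%:E <= torus_norm +oo phi)%E}.
Proof.
rewrite /torus_norm unlock /= torus_measureT lte01.
apply: torus_aeS (ess_sup_ge (torus_measure R) (abse \o (EFin \o phi))) => x.
by [].
Qed.

Lemma torus_powR_bounded (R : realType) (phi : R -> R) (p : R) :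
  continuous phi -> 0 <= p -> torus_bounded (fun x => `|phi x| `^ p).
Proof.
move=> cphi p0; have [K phiK] := continuous_bounded01 cphi; split.
  apply: (@measurableT_comp _ _ _ _ _ _ (fun y : R => powR y p)) => //.
  by apply: measurableT_comp => //; exact: continuous_measurable_fun.
exists (K `^ p) => x /andP[x0 /ltW x1]; rewrite ger0_norm ?powR_ge0//.
have xK : `|phi x| <= K by rewrite phiK// x0.
by apply: ge0_ler_powR; rewrite ?nnegrE// (le_trans _ xK).
Qed.

Lemma torus_norm_fin_num (R : realType) (p : \bar R) (phi : R -> R) :
  continuous phi -> (1 <= p)%E -> torus_norm p phi \is a fin_num.
Proof.
move=> cphi p1; rewrite ge0_fin_numE ?Lnorm_ge0//.
have [K phiK] := continuous_bounded01 cphi.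
rewrite /torus_norm unlock; case: p p1 => [p p1| _|//]; last first.
  rewrite torus_measureT lte01; apply: (@le_lt_trans _ _ K%:E); last exact: ltry.
  apply/ess_supP; apply: torus_ae => x /andP[x0 /ltW x1].
  by rewrite lee_fin phiK// x0.
have p0 : 0 < p by rewrite (lt_le_trans ltr01).
apply: poweR_lty; under eq_integral do rewrite /= .
have iP := torus_bounded_int (torus_powR_bounded cphi (ltW p0)).
have := integrable_fin_num measurableT iP.
by rewrite ge0_fin_numE//; apply: integral_ge0 => x _; rewrite lee_fin powR_ge0.
Qed.

(** By periodicity some point of [0, 1[ has phi <> 0, and by continuity |phi| is
positive on a short interval to its right, over which the primitive of |phi|
strictly increases. *)
Lemma torus_mass_gt0 (R : realType) (phi : R -> R) : continuous phi ->
  periodic phi 1 -> (exists x, phi x != 0) ->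
  0 < \int[torus_measure R]_x `|phi x|.
Proof.
move=> cphi pphi [x0 phix0].
have cn := continuous_normr cphi.
have [V cV dV] := continuous_primitive cn; rewrite (torus_FTC cn dV).
have pz (z : int) y : phi (y + z%:~R) = phi y.
  case: z => m.
    by elim: m y => [|m IHm] y; rewrite ?addr0// -addn1 PoszD intrD addrA pphi IHm.
  rewrite NegzE mulrNz; elim: m.+1 y => [|m' IHm] y; first by rewrite subr0.
  by rewrite -addn1 PoszD intrD opprD addrA -[RHS](IHm y) -[LHS]pphi subrK.
pose x := x0 - (Num.floor x0)%:~R.
have phix : phi x != 0 by rewrite /x -mulrNz pz.
have /andP[x_ge0 x_lt1] : 0 <= x < 1.
  have := floor_itv x0; rewrite /x => /andP[? ?].
  by rewrite subr_ge0 ltrBlDr addrC -intrD1; apply/andP.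
have [d /= d0 phid] : exists2 d : R, 0 < d & forall y, `|x - y| < d -> phi y != 0.
  have nz : \forall y \near x, phi y != 0.
    have px : 0 < `|phi x| by rewrite normr_gt0.
    move/cvgrPdist_lt : (cphi x) => /(_ _ px); apply: filterS => y.
    by apply: contraTneq => ->; rewrite subr0 ltxx.
  by have /nbhs_ballP [d d0 hd] := nz; exists d.
(* y stays within the neighbourhood of radius d of x and below 1. *)
pose y := Num.min (x + d / 2) ((x + 1) / 2).
have xy : x < y by rewrite /y lt_min; apply/andP; split; lra.
have y1 : y < 1 by rewrite /y gt_min; apply/orP; right; lra.
have yd : y <= x + d / 2 by rewrite /y ge_min lexx.
have mvt (a b : R) : 0 <= a -> a <= b -> b <= 1 ->
    exists2 c, a <= c <= b & V b - V a = `|phi c| * (b - a).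
  move=> a0 ab b1.
  have sub z : z \in `[a, b]%R -> 0 <= z <= 1.
    by rewrite in_itv/= => /andP[az zb]; rewrite (le_trans a0)// (le_trans zb).
  have [||c cI ->] := @MVT_segment R V (fun x => `|phi x|) a b ab.
  - by move=> z /subset_itv_oo_cc /sub; exact: dV.
  - apply: derivable_within_continuous => z /sub zI.
    exact: (@ex_derive _ _ _ _ _ _ _ (dV z zI)).
  by exists c.
have [c1 _ E1] := mvt 0 x (lexx 0) x_ge0 (ltW x_lt1).
have [c2 /andP[c2x c2y] E2] := mvt x y x_ge0 (ltW xy) (ltW y1).
have [c3 _ E3] := mvt y 1 (le_trans x_ge0 (ltW xy)) (ltW y1) (lexx 1).
have -> : V 1 - V 0 = (V x - V 0) + (V y - V x) + (V 1 - V y) by lra.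
rewrite E1 E2 E3 subr0 -addrA ltr_wpDl ?mulr_ge0//.
rewrite ltr_pwDl ?mulr_ge0 ?subr_ge0 ?(ltW y1)// mulr_gt0 ?subr_gt0// normr_gt0 phid//.
by rewrite ltr_norml; apply/andP; split; lra.
Qed.

Lemma conj_exp_y (R : realType) : conj_exp +oo = 1 :> R.
Proof. by rewrite /conj_exp hoelder_conjugatey. Qed.

Lemma torus_norm_powR (R : realType) (phi : R -> R) (p : R) : continuous phi -> 0 < p ->
  torus_norm p%:E phi = ((\int[torus_measure R]_x (`|phi x| `^ p)) `^ p^-1)%:E.
Proof.
move=> cphi p0; rewrite /torus_norm unlock -poweR_EFin; congr (poweR _ _).
rewrite /Rintegral fineK//.
exact: integrable_fin_num (torus_bounded_int (torus_powR_bounded cphi (ltW p0))).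
Qed.

(** Hoelder's inequality with the indicator of E; for r = +oo it degenerates to the
essential bound on phi. *)
Lemma mass_on_set_le (R : realType) (phi : R -> R) (r : \bar R) (E : set R) (B m : R) :
  continuous phi -> (1 < r)%E -> measurable E ->
  torus_norm r phi = B%:E -> torus_measure R E = m%:E ->
  \int[torus_measure R]_x (`|phi x| * \1_E x) <= B * m `^ (conj_exp r)^-1.
Proof.
move=> cphi r1 mE BE ME.
have m0 : 0 <= m by rewrite -lee_fin -ME.
have B0 : 0 <= B by rewrite -lee_fin -BE Lnorm_ge0.
have mphi : measurable_fun setT phi by exact: continuous_measurable_fun.
have mn : measurable_fun setT (fun x => `|phi x|) by exact: measurableT_comp.
have mI : measurable_fun setT (\1_E : R -> R) by exact: measurable_indic.
have mnI : measurable_fun setT (fun x => `|phi x| * \1_E x) by exact: measurable_funM.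
have nIb : torus_bounded (fun x => `|phi x| * \1_E x).
  have [K phiK] := continuous_bounded01 cphi; split => //.
  exists K => x /andP[x0 /ltW x1]; have xK : `|phi x| <= K by rewrite phiK// x0.
  rewrite normrM normr_id (le_trans _ xK)// ler_piMr// indicE.
  by case: (x \in E); rewrite ?normr1 ?normr0.
rewrite -lee_fin /Rintegral fineK; last first.
  exact: integrable_fin_num (torus_bounded_int nIb).
case: r r1 BE => [r r1 BE|_ BE|//].
  have r0 : 0 < r by rewrite (lt_trans ltr01).
  have r10 : 0 < r - 1 by rewrite subr_gt0.
  rewrite conj_exp_fin//; set q := r / (r - 1).
  have q0 : 0 < q by rewrite divr_gt0.
  have pq : r^-1 + q^-1 = 1 by rewrite /q; field; rewrite !gt_eqF.
  have := hoelder (torus_measure R) mn mI r0 q0 pq.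
  rewrite Lnorm1.
  have -> : Lnorm (torus_measure R) r%:E (EFin \o (fun x => `|phi x|)) = B%:E.
    by rewrite -BE /torus_norm -[RHS]Lnorm_abse; apply: eq_Lnorm => x /=.
  have -> : Lnorm (torus_measure R) q%:E (EFin \o (\1_E : R -> R)) = (m `^ q^-1)%:E.
    rewrite unlock -poweR_EFin -ME; congr (poweR _ _).
    rewrite -[in RHS](setIT E) -integral_indic//.
    apply: eq_integral => x _ /=; rewrite indicE.
    by case: (x \in E); rewrite /= ?normr1 ?powR1 ?normr0 ?powR0// gt_eqF.
  rewrite -EFinM; apply: le_trans; rewrite le_eqVlt; apply/orP; left; apply/eqP.
  apply: eq_integral => x _ /=; rewrite normrM normr_id indicE.
  by case: (x \in E); rewrite ?normr1 ?normr0.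
rewrite conj_exp_y invr1 powRr1//.
have := torus_norm_ae_le phi; rewrite BE => phiB.
apply: (@le_trans _ _ (\int[torus_measure R]_x (B * \1_E x)%:E)%E).
  apply: ae_ge0_le_integral => //.
  - exact/measurable_EFinP.
  - by move=> x _; rewrite lee_fin mulr_ge0// indicE; case: (x \in E).
  - by apply/measurable_EFinP; apply: measurable_funM => //; exact: measurable_cst.
  - apply: torus_aeS phiB => x xB _; rewrite lee_fin in xB *; exact: ler_wpM2r.
under eq_integral do rewrite EFinM.
rewrite ge0_integralZl//; last first.
- exact/measurable_EFinP.
by rewrite integral_indic// setIT ME.
Qed.

Lemma torus_mass_le_norm (R : realType) (phi : R -> R) (r : \bar R) (B : R) :
  continuous phi -> (1 < r)%E -> torus_norm r phi = B%:E ->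
  \int[torus_measure R]_x `|phi x| <= B.
Proof.
move=> cphi r1 BE.
have := mass_on_set_le cphi r1 measurableT BE (torus_measureT R).
rewrite powR1 mulr1; congr (_ <= _); apply: eq_Rintegral => x _.
by rewrite indicT /= mulr1.
Qed.

(** Lyapunov's inequality. For finite r, write |phi|^p as the product of
|phi|^(1 - al) and |phi|^(r al) with al = (p - 1) / (r - 1), and apply Hoelder's
inequality with exponents 1 / (1 - al) and 1 / al; for r = +oo, bound
|phi|^(p - 1) by its essential supremum. *)
Lemma torus_norm_interpolation (R : realType) (phi : R -> R)
    (p a B P rho th : R) (r : \bar R) :
  rho = fine r^-1%E -> th = (p^-1 - rho) / (1 - rho) ->
  continuous phi -> 1 <= p -> (p%:E < r)%E ->
  a = \int[torus_measure R]_x `|phi x| -> 0 < a -> torus_norm r phi = B%:E ->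
  torus_norm p%:E phi = P%:E ->
  P <= a `^ th * B `^ (1 - th).
Proof.
move=> rhoE0 thE0 cphi p1 pr aE a0 BE PE.
have p0 : 0 < p by rewrite (lt_le_trans ltr01).
have r1 : (1 < r)%E by rewrite (le_lt_trans _ pr)// lee_fin.
have aB : a <= B by rewrite aE; exact: torus_mass_le_norm BE.
have B0 : 0 < B by exact: lt_le_trans aB.
move: PE; rewrite torus_norm_powR// => -[<-].
set J := Rintegral _ _ _.
have J0 : 0 <= J by apply: Rintegral_ge0 => x _; exact: powR_ge0.
have cn := continuous_normr cphi.
have p1' : 0 <= p - 1 by rewrite subr_ge0.
suff JE : J <= (a `^ th * B `^ (1 - th)) `^ p.
  apply: (@le_trans _ _ (((a `^ th * B `^ (1 - th)) `^ p) `^ p^-1)).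
    by apply: ge0_ler_powR; rewrite ?nnegrE ?invr_ge0 ?(ltW p0) ?powR_ge0.
  by rewrite -powRrM mulfV ?gt_eqF// powRr1// mulr_ge0// powR_ge0.
rewrite powRM ?powR_ge0// -!powRrM.
case: r r1 pr BE rhoE0 => [r r1 pr BE rhoE0|_ _ BE rhoE0|//]; last first.
  have -> : th = p^-1 by rewrite thE0 rhoE0 invey /= !subr0 divr1.
  rewrite mulVf ?gt_eqF// powRr1 ?(ltW a0)// mulrBl mul1r mulVf ?gt_eqF// aE mulrC.
  rewrite -RintegralZl//; last exact: torus_continuous_integrable.
  have cB : torus_bounded (fun x => B `^ (p - 1) * `|phi x|).
    by apply: torus_boundedM; [exact: torus_bounded_cst|exact: torus_bounded_continuous].
  have cp := torus_powR_bounded cphi (ltW p0).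
  rewrite -lee_fin /J /Rintegral !fineK; last 2 first.
  - exact: integrable_fin_num (torus_bounded_int cB).
  - exact: integrable_fin_num (torus_bounded_int cp).
  apply: ae_ge0_le_integral => //.
  - by apply/measurable_EFinP; exact: cp.1.
  - by move=> x _; rewrite lee_fin mulr_ge0// powR_ge0.
  - by apply/measurable_EFinP; exact: cB.1.
  have := torus_norm_ae_le phi; rewrite BE; apply: torus_aeS => x xB _.
  rewrite lee_fin in xB *; rewrite -(mulr_powRB1 (normr_ge0 _) p0) mulrC.
  by apply: ler_wpM2r => //; apply: ge0_ler_powR; rewrite ?nnegrE ?(ltW B0).
rewrite !lte_fin in r1 pr.
have r0 : 0 < r by rewrite (lt_trans ltr01).
have r10 : 0 < r - 1 by rewrite subr_gt0.
have rhoE : rho = r^-1 by rewrite rhoE0 inver gt_eqF.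
have thE : th = (r - p) / (p * (r - 1)).
  by rewrite thE0 rhoE; field; rewrite !gt_eqF//= subr_gt0.
move: BE; rewrite torus_norm_powR// => -[BE].
set I := Rintegral _ _ _ in BE.
have I0 : 0 <= I by apply: Rintegral_ge0 => x _; exact: powR_ge0.
rewrite -BE -powRrM.
have [p_eq1|pn1] := eqVneq p 1.
  have -> : th = 1 by rewrite thE p_eq1; field; rewrite gt_eqF.
  rewrite subrr mul0r mulr0 powRr0 mulr1 mul1r p_eq1 powRr1 ?(ltW a0)// aE /J p_eq1.
  rewrite le_eqVlt; apply/orP; left; apply/eqP.
  by apply: eq_Rintegral => x _; rewrite powRr1.
have p1lt : 0 < p - 1 by rewrite subr_gt0 lt_neqAle eq_sym pn1.
pose al := (p - 1) / (r - 1).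
have al0 : 0 < al by rewrite divr_gt0.
have al1 : 0 < 1 - al by rewrite subr_gt0 /al ltr_pdivrMr// mul1r; lra.
have -> : th * p = 1 - al by rewrite thE /al; field; rewrite !gt_eqF.
have -> : r^-1 * ((1 - th) * p) = al by rewrite thE /al; field; rewrite !gt_eqF.
have mpow (e : R) : 0 <= e -> measurable_fun setT (fun x => `|phi x| `^ e).
  by move=> e0; exact: (torus_powR_bounded cphi e0).1.
have ral0 : 0 < r * al by rewrite mulr_gt0.
have P0 : 0 < (1 - al)^-1 by rewrite invr_gt0.
have Q0 : 0 < al^-1 by rewrite invr_gt0.
have PQ : (1 - al)^-1^-1 + al^-1^-1 = 1 by rewrite !invrK; ring.
have := hoelder (torus_measure R) (mpow _ (ltW al1)) (mpow _ (ltW ral0)) P0 Q0 PQ.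
rewrite Lnorm1 unlock !invrK.
have powN (e e' : R) : 0 < e -> e != 0 -> forall x : R,
   poweR (abse ((EFin \o (fun x => `|phi x| `^ e)) x)) e' = (`|phi x| `^ (e * e'))%:E.
  by move=> e0 en0 x; rewrite /= ger0_norm ?powR_ge0// powRrM.
under [in X in (_ <= X)%E]eq_integral => x _
  do rewrite powN ?(gt_eqF al1)// divff ?(gt_eqF al1)// powRr1//.
under [in X in (_ <= _ * X)%E]eq_integral => x _
  do rewrite powN ?(gt_eqF ral0)// mulfK ?(gt_eqF al0)//.
have fE (f : R -> R) : torus_bounded f ->
   (\int[torus_measure R]_x (f x)%:E = (\int[torus_measure R]_x f x)%:E)%E.
  by move=> fb; rewrite /Rintegral fineK//; exact: integrable_fin_num (torus_bounded_int fb).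
have -> : (\int[torus_measure R]_x
    abse ((EFin \o ((fun x => `|phi x| `^ (1 - al)) \* (fun x => `|phi x| `^ (r * al)))%R) x)
    = J%:E)%E.
  rewrite -(fE (fun x => `|phi x| `^ p)); last exact: torus_powR_bounded (ltW p0).
  apply: eq_integral => x _ /=; rewrite ger0_norm ?mulr_ge0 ?powR_ge0//; congr EFin.
  have e : 1 - al + r * al = p by rewrite /al; field; rewrite gt_eqF.
  by rewrite -powRD ?e// (gt_eqF p0).
rewrite fE; last exact: torus_bounded_continuous.
rewrite fE; last exact: torus_powR_bounded (ltW r0).
rewrite !poweR_EFin -EFinM -aE -/I.
by rewrite lee_fin.
Qed.

(** * The uncertainty inequality *)

(** Where |Phi| < lam the weight of [mass_where_primitive_small] is at least 1/2, so
the mass there is at most twice the weighted mass, and lam is chosen to make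
this a / 2. *)
Lemma half_mass_superlevel (R : realType) (phi Phi : R -> R) (a lam N : R) :
  continuous phi -> continuous Phi ->
  (forall x : R, 0 <= x <= 1 -> is_derive x 1 Phi (phi x)) ->
  \int[torus_measure R]_x phi x = 0 ->
  a = \int[torus_measure R]_x `|phi x| -> 0 < a -> 0 < N ->
  sign_changes phi = N%:E -> lam = a / (8 * pi * N) ->
  a / 2 <= \int[torus_measure R]_x (`|phi x| * \1_[set x | lam <= `|Phi x|] x).
Proof.
move=> cphi cPhi dPhi phi0 aE a0 N0 NE lamE.
have lam0 : 0 < lam by rewrite lamE divr_gt0// mulr_gt0// mulr_gt0 ?pi_gt0.
have mE : measurable [set x | lam <= `|Phi x|].
  by apply: measurable_superlevel; exact: continuous_measurable_fun.
have nb := torus_bounded_continuous (continuous_normr cphi).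
pose w x := (1 + (Phi x / lam) ^+ 2)^-1.
have w_half x : `|Phi x| < lam -> 1 <= 2 * w x.
  move=> Plt; rewrite /w -ler_pdivrMr ?invr_gt0 ?ltr_pwDl ?sqr_ge0// invrK mul1r.
  have : (Phi x / lam) ^+ 2 <= 1; last by lra.
  rewrite -real_normK ?num_real// expr_le1// normrM normfV (gtr0_norm lam0).
  by rewrite ler_pdivrMr// mul1r ltW.
have wI x : 0 <= w x <= 1.
  have q := sqr_ge0 (Phi x / lam).
  by rewrite /w invr_ge0 invf_le1 ?ltr_pwDl// lerDl q andbT addr_ge0.
have wb : torus_bounded w.
  split; last by exists 1 => x _; have /andP[w0 w1] := wI x; rewrite ger0_norm.
  apply: measurable_funV_real; apply: measurable_funD; first exact: measurable_cst.
  apply: measurable_funX; apply: measurable_funM; last exact: measurable_cst.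
  exact: continuous_measurable_fun.
set E := [set x | _].
have Ib : torus_bounded (\1_E : R -> R).
  split; first exact: measurable_indic.
  by exists 1 => x _; rewrite indicE; case: (x \in E); rewrite ?normr1 ?normr0.
have wnb := torus_boundedM wb nb; have nIb := torus_boundedM nb Ib.
have wnb2 := torus_boundedM (torus_bounded_cst 2) wnb.
have : a <= \int[torus_measure R]_x (2 * (w x * `|phi x|) + `|phi x| * \1_E x).
  rewrite aE; apply: torus_le_Rintegral; [exact: torus_bounded_int| |].
    by apply: torus_bounded_int; exact: torus_boundedD.
  move=> x _; have /andP[w0 _] := wI x; rewrite indicE.
  have [xE|xnE] := boolP (x \in E).
    by rewrite mulr1 lerDr mulr_ge0// mulr_ge0.
  rewrite mulr0 addr0 mulrA ler_peMl// w_half// ltNge.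
  by apply: contra xnE => /= xE; rewrite inE.
rewrite torus_integralD// torus_integralZ//.
have := mass_where_primitive_small cphi cPhi dPhi phi0.
rewrite -aE => /(_ _ _ a0 lam0 NE); rewrite -/(w _).
have -> : 2 * pi * lam * N = a / 4.
  have cancel (p n : R) : 0 < p -> 0 < n -> 2 * p * (a / (8 * p * n)) * n = a / 4.
    by move=> p0 n0; field; rewrite !gt_eqF.
  by rewrite lamE cancel ?pi_gt0.
set X := Rintegral _ _ _; set Y := Rintegral _ _ _; clear; lra.
Qed.

(** The factors come from half of the mass (2), from the strip height
lam = a / (8 pi N), from the coefficient bound 2 D, and from the weak-type
constant 2 * 4^(s - 1). *)
Definition uncertainty_constant (R : realType) (s r' : R) : R :=
  16 * pi * 2 `^ (r' / s) * (2 * 4 `^ (s - 1)) `^ s^-1.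

Lemma uncertainty_constant_gt0 (R : realType) (s r' : R) : 0 < uncertainty_constant s r'.
Proof. by rewrite /uncertainty_constant !mulr_gt0 ?powR_gt0 ?pi_gt0. Qed.

Lemma power_ratio_arith (R : realType) (s r' a B N D m lam : R) :
  0 < s -> 0 < r' -> 0 < a -> 0 < B -> 0 < N -> 0 <= D -> 0 <= m ->
  lam = a / (8 * pi * N) -> a / 2 <= B * m `^ r'^-1 ->
  m <= 2 * 4 `^ (s - 1) * (2 * D / lam) `^ s ->
  a `^ (1 + r' / s) / B `^ (r' / s) <= uncertainty_constant s r' * N * D.
Proof.
move=> s0 r'0 a0 B0 N0 D0 m0 lamE a_half mK.
set K := 2 * 4 `^ (s - 1) in mK.
have K0 : 0 <= K by rewrite mulr_ge0// powR_ge0.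
have lam0 : 0 < lam by rewrite lamE divr_gt0// mulr_gt0// mulr_gt0 ?pi_gt0.
have Dl0 : 0 <= 2 * D / lam by rewrite divr_ge0 ?mulr_ge0// ltW.
have r's : 0 <= r' / s by rewrite divr_ge0// ltW.
have x0 : 0 <= a / (2 * B) by rewrite divr_ge0 ?mulr_ge0// ltW.
have x_le : a / (2 * B) <= (K * (2 * D / lam) `^ s) `^ r'^-1.
  apply: (@le_trans _ _ (m `^ r'^-1)).
    by rewrite invfM mulrA ler_pdivrMr// [leRHS]mulrC.
  by apply: ge0_ler_powR; rewrite ?nnegrE ?invr_ge0 ?(ltW r'0)// mulr_ge0 ?powR_ge0.
have key : (a / (2 * B)) `^ (r' / s) <= K `^ s^-1 * (2 * D / lam).
  apply: (@le_trans _ _ (((K * (2 * D / lam) `^ s) `^ r'^-1) `^ (r' / s))).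
    by apply: ge0_ler_powR; rewrite ?nnegrE ?powR_ge0.
  rewrite -powRrM mulrA mulVf ?gt_eqF// mul1r powRM ?powR_ge0//.
  by rewrite -powRrM mulfV ?gt_eqF// powRr1.
have -> : a `^ (1 + r' / s) / B `^ (r' / s)
    = (a / (2 * B)) `^ (r' / s) * (2 `^ (r' / s) * a).
  rewrite powRD; last by rewrite (gt_eqF a0) implybT.
  rewrite powRr1 ?(ltW a0)// powRM ?invr_ge0 ?mulr_ge0 ?(ltW a0) ?(ltW B0)//.
  rewrite -[(2 * B)^-1]powR_inv1 ?mulr_ge0 ?(ltW B0)// -powRrM mulN1r powRN.
  rewrite powRM ?(ltW B0)//; field.
  by rewrite !gt_eqF ?powR_gt0.
apply: (le_trans (ler_wpM2r _ key)); first by rewrite mulr_ge0 ?powR_ge0 ?(ltW a0).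
rewrite le_eqVlt /uncertainty_constant -/K lamE; apply/orP; left; apply/eqP.
have cancel (p n x y : R) : 0 < p -> 0 < n ->
    x * (2 * D / (a / (8 * p * n))) * (y * a) = 16 * p * y * x * n * D.
  by move=> p0 n0; field; rewrite !gt_eqF.
exact: cancel (pi_gt0 R) N0.
Qed.

Lemma conj_exp_ge1 (R : realType) (r : \bar R) : (1 < r)%E -> 1 <= conj_exp r.
Proof.
case: r => [r|_|//]; last by rewrite conj_exp_y.
by rewrite lte_fin => r1; rewrite conj_exp_fin// ler_pdivlMr ?subr_gt0// mul1r gerBl.
Qed.

(** The weak-type bound needs a positive bound on the coefficients, whereas the
denominator M^-1 H + G is not known to be positive in advance. It is enlarged by
an arbitrarily small amount; positivity is then a consequence of the inequality
itself, because its left-hand side is positive. *)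
Lemma power_ratio_le (R : realType) (s M H G a B N : R) (r : \bar R)
    (phi : R -> R) (h g : R -> R[i]) :
  2 <= s -> (1 < r)%E -> split_function s M phi h g ->
  seq_norm (conj_exp s%:E) (fourier_coef h) = H%:E ->
  fourier_lebesgue_norm (conj_exp s%:E) g = G%:E ->
  a = \int[torus_measure R]_x `|phi x| -> torus_norm r phi = B%:E ->
  sign_changes phi = N%:E ->
  a `^ (1 + conj_exp r / s) / B `^ (conj_exp r / s)
    <= uncertainty_constant s (conj_exp r) * N * (M^-1 * H + G).
Proof.
move=> s2 r1 spl HE GE aE BE NE.
have [M0 pphi cphi nz phi0 _ _ _ _ _ _ _ _ _] := spl.
have D0 : 0 <= M^-1 * H + G.
  have H0 : 0 <= H by rewrite -lee_fin -HE poweR_ge0.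
  have G0 : 0 <= G by rewrite -lee_fin -GE poweR_ge0.
  by rewrite addr_ge0// mulr_ge0// invr_ge0 ltW.
have a0 : 0 < a by rewrite aE; exact: torus_mass_gt0.
have B0 : 0 < B by apply: (lt_le_trans a0); rewrite aE; exact: torus_mass_le_norm BE.
have N0 : 0 < N.
  apply: (@lt_le_trans _ _ 2%:R) => //; rewrite -lee_fin -NE.
  apply: ereal_sup_ubound; exists 2%N => //.
  by apply: mean_zero_alternates => //; rewrite -aE.
have r'0 : 0 < conj_exp r by apply: lt_le_trans (conj_exp_ge1 r1).
have s0 : 0 < s by apply: lt_le_trans s2.
have t0 : 0 <= s / (s - 1).
  by rewrite divr_ge0 ?(ltW s0)// subr_ge0 (le_trans _ s2)// ler1n.
apply/ler_addgt0Pr => e e0.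
set C := uncertainty_constant s _.
have CN0 : 0 < C * N by rewrite mulr_gt0 ?uncertainty_constant_gt0.
set D := M^-1 * H + G in D0 *; pose D' := D + e / (C * N).
have DD' : D < D' by rewrite ltrDl divr_gt0.
have D'0 : 0 < D' by apply: le_lt_trans DD'.
have -> : C * N * D + e = C * N * D'.
  by rewrite /D' [RHS]mulrDr [C * N * (e / _)]mulrCA mulfV ?mulr1// gt_eqF.
have [F cF dF] := continuous_primitive cphi.
pose c := \int[torus_measure R]_x F x.
pose Phi x := F x - c.
have cPhi : continuous Phi by move=> x; apply: cvgB; [exact: cF|exact: cvg_cst].
have dPhi (x : R) : 0 <= x <= 1 -> is_derive x 1 Phi (phi x).
  move=> xI; apply: (is_derive_eq (is_deriveB (dF x xI) (is_derive_cst c x 1))).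
  by rewrite subr0.
have Phi01 : Phi 0 = Phi 1.
  by have := torus_FTC cphi dPhi; rewrite phi0 => /esym/eqP; rewrite subr_eq0 => /eqP ->.
have Phi0 : \int[torus_measure R]_x Phi x = 0.
  rewrite torus_integralB; [|exact: torus_bounded_continuous|exact: torus_bounded_cst].
  by rewrite Rintegral_cst// torus_measureT /= mulr1 subrr.
pose lam := a / (8 * pi * N).
have lam0 : 0 < lam by rewrite divr_gt0// mulr_gt0// mulr_gt0 ?pi_gt0.
have D'2 : 0 < 2 * D' by rewrite mulr_gt0.
have coefA n := split_coef_bound n s2 spl HE GE.
have {coefA}coefA n : \sum_(i < n)
     (Num.sqrt ((\int[torus_measure R]_x (phi x * cos (2 * pi * i.+1%:R * x))) ^+ 2
              + (\int[torus_measure R]_x (phi x * sin (2 * pi * i.+1%:R * x))) ^+ 2)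
      / (2 * pi * i.+1%:R)) `^ (s / (s - 1)) <= (2 * D') `^ (s / (s - 1)).
  apply: (le_trans (coefA n)); apply: ge0_ler_powR => //.
  - by rewrite nnegrE mulr_ge0.
  - by rewrite nnegrE ltW.
  - by rewrite ler_pM2l// ltW.
have mE : measurable [set x | lam <= `|Phi x|].
  by apply: measurable_superlevel; exact: continuous_measurable_fun.
have mK := primitive_superlevel s2 lam0 D'2 cphi cPhi dPhi Phi01 Phi0 coefA.
have mfin : torus_measure R [set x | (lam <= `|Phi x|)%R] \is a fin_num.
  by rewrite ge0_fin_numE//; apply: (le_lt_trans mK); exact: ltry.
have mfinE := esym (fineK mfin); set m := fine _ in mfinE.
have half := half_mass_superlevel cphi cPhi dPhi phi0 aE a0 N0 NE (erefl lam).
have high := mass_on_set_le cphi r1 mE BE mfinE.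
apply: (power_ratio_arith s0 r'0 a0 B0 N0 (ltW D'0) _ (erefl lam) (le_trans half high)).
- by rewrite -lee_fin -mfinE.
- by rewrite -lee_fin -mfinE.
Qed.

(** * Reduction of the product ratio and conclusion *)

Lemma inve_ge1 (R : realType) (p : \bar R) : (1 <= p)%E ->
  exists2 x : R, (p^-1)%E = x%:E & 0 <= x <= 1.
Proof.
case: p => [p p1|_|//]; last by exists 0; rewrite ?invey// lexx ler01.
have p0 : 0 < p by rewrite (lt_le_trans ltr01).
exists p^-1; first by rewrite inver gt_eqF.
by rewrite invr_ge0 (ltW p0) invf_le1.
Qed.

Lemma inve_fin_gt0 (R : realType) (p : \bar R) (x : R) : (1 <= p)%E -> (p^-1)%E = x%:E ->
  0 < x -> exists2 y, p = y%:E & 1 <= y /\ x = y^-1.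
Proof.
case: p => [p|_|//]; last by rewrite invey => -[<-]; rewrite ltxx.
rewrite lee_fin => p1; have p0 : 0 < p := lt_le_trans ltr01 p1.
by rewrite inver gt_eqF// => -[<-] _; exists p.
Qed.

Lemma conj_expE (R : realType) (r : \bar R) (rho : R) : (1 < r)%E -> (r^-1)%E = rho%:E ->
  conj_exp r = (1 - rho)^-1.
Proof.
case: r => [r|_|//]; last by rewrite invey conj_exp_y => -[<-]; rewrite subr0 invr1.
rewrite lte_fin => r1; have r0 : 0 < r by rewrite (lt_trans ltr01).
rewrite inver gt_eqF// conj_exp_fin// => -[<-].
by field; rewrite (gt_eqF r0) /= gt_eqF// subr_gt0.
Qed.

(** With rho = 1/r, interpolation bounds the product ratio by
a ^ Th * B ^ (1 - Th), where Th = (1/p + 1/q - 2 rho) / (1 - rho), and the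
condition on the exponents says exactly that Th >= 1 + r'/s. As a <= B, lowering
the exponent of a / B to 1 + r'/s only increases the bound. *)
Lemma product_ratio_le (R : realType) (s a P Q B : R) (p q r : \bar R) (phi : R -> R) :
  0 < s -> (1 <= p)%E -> (1 <= q)%E -> (1 <= r)%E ->
  (1 + (s^-1)%:E <= p^-1 + q^-1 - r^-1)%E -> continuous phi ->
  a = \int[torus_measure R]_x `|phi x| -> 0 < a ->
  torus_norm p phi = P%:E -> torus_norm q phi = Q%:E -> torus_norm r phi = B%:E ->
  (1 < r)%E /\
  P * Q / B <= a `^ (1 + conj_exp r / s) / B `^ (conj_exp r / s).
Proof.
move=> s0 p1 q1 r1 pqr cphi aE a0 PE QE BE.
have [ip ipE /andP[ip0 ip1]] := inve_ge1 p1.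
have [iq iqE /andP[iq0 iq1]] := inve_ge1 q1.
have [rho rhoE /andP[rho0 rho1]] := inve_ge1 r1.
move: pqr; rewrite ipE iqE rhoE -EFinN -!EFinD lee_fin => pqr.
have si : 0 < s^-1 by rewrite invr_gt0.
have rho_lt1 : rho < 1 by lra.
have r_gt1 : (1 < r)%E.
  rewrite lt_neqAle r1 andbT; apply/eqP => re; move: rhoE; rewrite -re inve1 => -[re1].
  by move: rho_lt1; rewrite -re1 ltxx.
split => //.
have aB : a <= B by rewrite aE; exact: torus_mass_le_norm BE.
have B0 : 0 < B by exact: lt_le_trans aB.
have below (x : \bar R) (ix X : R) : (1 <= x)%E -> (x^-1)%E = ix%:E -> rho < ix ->
    torus_norm x phi = X%:E ->
    X <= a `^ ((ix - rho) / (1 - rho)) * B `^ (1 - (ix - rho) / (1 - rho)).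
  move=> x1 ixE rix XE; have [y yE [y1 iy]] := inve_fin_gt0 x1 ixE (le_lt_trans rho0 rix).
  apply: (@torus_norm_interpolation _ phi y a B X rho _ r) => //.
  - by rewrite rhoE.
  - by rewrite iy.
  - rewrite yE in XE *; move: rhoE.
    case: (r) r_gt1 => [z z1|_ _|//]; last by rewrite ltry.
    rewrite lte_fin in z1; rewrite lte_fin inver gt_eqF ?(lt_trans ltr01 z1)// => -[zE].
    move: rix; rewrite iy -zE ltf_pV2// posrE; lra.
  - by rewrite -yE.
have Pn : 0 <= P by rewrite -lee_fin -PE Lnorm_ge0.
have Qn : 0 <= Q by rewrite -lee_fin -QE Lnorm_ge0.
have rp : rho < ip by lra.
have rq : rho < iq by lra.
have Ple := below _ _ _ p1 ipE rp PE.
have Qle := below _ _ _ q1 iqE rq QE.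
set tp := (ip - rho) / _ in Ple; set tq := (iq - rho) / _ in Qle.
have r'E := conj_expE r_gt1 rhoE; set T := 1 + conj_exp r / s.
have Tle : T <= tp + tq.
  have -> : tp + tq = (ip + iq - 2 * rho) / (1 - rho) by rewrite /tp /tq; field; lra.
  rewrite ler_pdivlMr ?subr_gt0// /T r'E mulrDl mul1r.
  have -> : (1 - rho)^-1 / s * (1 - rho) = s^-1 by field; apply/andP; split; lra.
  lra.
have PQ : P * Q / B <= a `^ (tp + tq) * B `^ (1 - (tp + tq)).
  rewrite ler_pdivrMr//.
  apply: (le_trans (ler_pM Pn Qn Ple Qle)).
  have aD u v : a `^ (u + v) = a `^ u * a `^ v by rewrite powRD// (gt_eqF a0) implybT.
  have BD u v : B `^ (u + v) = B `^ u * B `^ v by rewrite powRD// (gt_eqF B0) implybT.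
  have BX : B `^ (1 - (tp + tq)) * B = B `^ ((1 - tp) + (1 - tq)).
    rewrite -{2}[B]powRr1 ?(ltW B0)// -BD; congr (B `^ _); ring.
  by rewrite -[leRHS]mulrA BX aD (BD (1 - tp)) mulrACA.
apply: (le_trans PQ).
have E (u : R) : a `^ u * B `^ (1 - u) = (a / B) `^ u * B.
  rewrite powRD; last by rewrite (gt_eqF B0) implybT.
  rewrite powRr1 ?(ltW B0)// powRM ?invr_ge0 ?(ltW a0) ?(ltW B0)//.
  by rewrite -[B^-1]powR_inv1 ?(ltW B0)// -powRrM mulN1r; ring.
have -> : a `^ T / B `^ (conj_exp r / s) = a `^ T * B `^ (1 - T).
  by congr (_ * _); rewrite -powRN /T; congr powR; ring.
rewrite !E; apply: ler_wpM2r; first exact: ltW.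
apply: ger_powR => //; rewrite divr_gt0//= ler_pdivrMr// mul1r//.
Qed.

Lemma sign_changes_ge0 (R : realType) (phi : R -> R) : (0 <= sign_changes phi)%E.
Proof.
apply: ereal_sup_ubound; exists 0%N => //.
by exists (fun=> 0); split=> [[]|[]].
Qed.

Lemma sign_changes_fin_num (R : realType) (phi : R -> R) :
  (sign_changes phi < +oo)%E -> sign_changes phi \is a fin_num.
Proof. by move=> lty; rewrite ge0_fin_numE// sign_changes_ge0. Qed.

Lemma fourier_lebesgue_norm_ge0 (R : realType) (t : R) (g : R -> R[i]) :
  (0 <= fourier_lebesgue_norm t g)%E.
Proof. exact: poweR_ge0. Qed.

Theorem theorem3p5 (R : realType) (s : R) (hs : 2 <= s) :
  (forall r : \bar R, exists2 C : R, 0 < C &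
     forall ratio : (R -> R) -> \bar R, admissible_ratio s r ratio ->
     forall (M : R) (phi : R -> R) (h g : R -> R[i]),
     split_function s M phi h g ->
     (C%:E * (ratio phi /
        ((M^-1)%:E * seq_norm (conj_exp s%:E) (fourier_coef h)
         + fourier_lebesgue_norm (conj_exp s%:E) g))
      <= sign_changes phi)%E) /\
  (forall (r : \bar R) (Lambda : R), (1 < r)%E -> 1 <= Lambda ->
     exists2 c : R, 0 < c &
     forall (M : R) (phi : R -> R) (h g : R -> R[i]),
     split_function s M phi h g ->
     ((Lambda^-1)%:E <= torus_norm 1%E phi <= Lambda%:E)%E ->
     ((Lambda^-1)%:E <= torus_norm r phi <= Lambda%:E)%E ->
     ((Lambda^-1)%:E <= seq_norm (conj_exp s%:E) (fourier_coef h)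
        <= Lambda%:E)%E ->
     (fourier_lebesgue_norm (conj_exp s%:E) g <= (Lambda * M^-1)%:E)%E ->
     ((c * M)%:E <= sign_changes phi)%E).
Proof.
have s0 : 0 < s by lra.
have snorm (f : R -> R[i]) : (0 <= seq_norm (conj_exp s%:E) (fourier_coef f))%E.
  by exact: poweR_ge0.
split=> [r|r Lam r1 Lam1].
  pose U := uncertainty_constant s (conj_exp r).
  have U0 : 0 < U by exact: uncertainty_constant_gt0.
  exists U^-1; first by rewrite invr_gt0.
  move=> ratio adm M phi h g spl.
  have [M0 pphi cphi nz phi0 Nfin _ _ _ _ _ _ hfin _] := spl.
  have NE := fineK (sign_changes_fin_num Nfin); set N := fine _ in NE.
  have HE : seq_norm (conj_exp s%:E) (fourier_coef h) \is a fin_num.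
    by rewrite ge0_fin_numE.
  have {HE}HE := fineK HE; set H := fine _ in HE.
  pose a := \int[torus_measure R]_x `|phi x|.
  have a0 : 0 < a by exact: torus_mass_gt0.
  have [r1 [B [Y [BE YE Yle]]]] : (1 < r)%E /\ exists B Y, [/\ torus_norm r phi = B%:E,
      ratio phi = Y%:E & Y <= a `^ (1 + conj_exp r / s) / B `^ (conj_exp r / s)].
    case: adm => [p q p1 q1 r1 pqr|r1].
      have PE := fineK (torus_norm_fin_num cphi p1).
      have QE := fineK (torus_norm_fin_num cphi q1).
      have BE := fineK (torus_norm_fin_num cphi r1).
      have [r_gt1 le] := product_ratio_le s0 p1 q1 r1 pqr cphi (erefl a) a0
        (esym PE) (esym QE) (esym BE).
      have B0 : 0 < fine (torus_norm r phi).
        by apply: (lt_le_trans a0); exact: torus_mass_le_norm (esym BE).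
      split=> //; eexists; eexists; split; [exact: esym BE| |exact: le].
      by rewrite -PE -QE -BE inver gt_eqF.
    have BE := fineK (torus_norm_fin_num cphi (ltW r1)).
    have B0 : 0 < fine (torus_norm r phi).
      by apply: (lt_le_trans a0); exact: torus_mass_le_norm (esym BE).
    split=> //; eexists; eexists; split; [exact: esym BE| |exact: lexx].
    by rewrite torus_norm1// -{1}BE !poweR_EFin inver gt_eqF ?powR_gt0.
  have B0 : 0 < B by apply: (lt_le_trans a0); exact: torus_mass_le_norm BE.
  rewrite YE -HE -NE.
  have := fourier_lebesgue_norm_ge0 (conj_exp s%:E) g.
  case GE : (fourier_lebesgue_norm (conj_exp s%:E) g) => [G| |//] G0; last first.
    (* The seminorm of g may be infinite; then the quotient is 0. *)
    have -> : ((M^-1)%:E * H%:E + +oo = +oo)%E by exact: addey.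
    rewrite invey !mule0 NE.
    exact: sign_changes_ge0.
  have key := power_ratio_le hs r1 spl (esym HE) GE (erefl a) BE (esym NE).
  set X := _ / _ in key Yle.
  have X0 : 0 < X by rewrite divr_gt0// powR_gt0.
  have N0 : 0 <= N by rewrite -lee_fin NE sign_changes_ge0.
  set D := M^-1 * H + G in key.
  (* D = 0 would make the positive ratio X vanish. *)
  have D0 : 0 < D.
    rewrite ltNge; apply/negP => D0; move: X0; rewrite ltNge => /negP; apply.
    by apply: (le_trans key); rewrite mulr_ge0_le0// mulr_ge0// ltW.
  rewrite -EFinM -EFinD -/D inver (gt_eqF D0) -!EFinM lee_fin.
  rewrite mulrA ler_pdivrMr// ler_pdivrMl// mulrA.
  exact: le_trans Yle key.
pose U := uncertainty_constant s (conj_exp r).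
have U0 : 0 < U by exact: uncertainty_constant_gt0.
have L0 : 0 < Lam by lra.
have e1 : 0 <= conj_exp r / s by rewrite divr_ge0//; have := conj_exp_ge1 r1; lra.
pose x := Lam^-1 `^ (1 + conj_exp r / s) / Lam `^ (conj_exp r / s).
have x0 : 0 < x by rewrite divr_gt0 ?powR_gt0// invr_gt0.
exists (x / (U * 2 * Lam)); first by rewrite divr_gt0// mulr_gt0// mulr_gt0.
move=> M phi h g spl; have [M0 pphi cphi nz phi0 Nfin _ _ _ _ _ _ hfin _] := spl.
have NE := fineK (sign_changes_fin_num Nfin); set N := fine _ in NE.
rewrite torus_norm1//; set a := Rintegral _ _ _; rewrite !lee_fin => /andP[aL _].
have BE := fineK (torus_norm_fin_num cphi (ltW r1)); set B := fine _ in BE.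
rewrite -BE !lee_fin => /andP[LB BL].
have HE : seq_norm (conj_exp s%:E) (fourier_coef h) \is a fin_num by rewrite ge0_fin_numE.
have {HE}HE := fineK HE; set H := fine _ in HE.
rewrite -HE !lee_fin => /andP[_ HL].
have := fourier_lebesgue_norm_ge0 (conj_exp s%:E) g.
case GE : (fourier_lebesgue_norm (conj_exp s%:E) g) => [G| //|//] G0.
rewrite lee_fin => GL.
have key := power_ratio_le hs r1 spl (esym HE) GE (erefl a) (esym BE) (esym NE).
have a0 : 0 < a by apply: lt_le_trans aL; rewrite invr_gt0.
have B0 : 0 < B by apply: lt_le_trans LB; rewrite invr_gt0.
have xle : x <= a `^ (1 + conj_exp r / s) / B `^ (conj_exp r / s).
  apply: ler_pM; rewrite ?powR_ge0 ?invr_ge0 ?powR_ge0//.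
    by apply: ge0_ler_powR; rewrite ?nnegrE ?invr_ge0 ?(ltW L0) ?(ltW a0)//; lra.
  rewrite lef_pV2 ?posrE ?powR_gt0//.
  by apply: ge0_ler_powR; rewrite ?nnegrE ?(ltW L0) ?(ltW B0).
have N0 : 0 <= N by rewrite -lee_fin NE sign_changes_ge0.
rewrite -NE lee_fin.
have DL : M^-1 * H + G <= 2 * Lam * M^-1.
  have := ler_wpM2l (_ : 0 <= M^-1) HL; rewrite invr_ge0 (ltW M0) => /(_ isT).
  by move: GL; rewrite [Lam * _]mulrC; lra.
have := le_trans (le_trans xle key) (ler_wpM2l (mulr_ge0 (ltW U0) N0) DL).
rewrite -mulrA -/U.
have -> : U * (N * (2 * Lam * M^-1)) = N * (U * 2 * Lam) / M by field; rewrite gt_eqF.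
rewrite ler_pdivlMr// => xM.
have UL0 : 0 < U * 2 * Lam by rewrite mulr_gt0// mulr_gt0.
by rewrite mulrAC ler_pdivrMr.
Qed.
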